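(* Let $d\ge1$, let $\alpha$ and $\beta$ be two irrational vectors in $\mathbb{R}^d$, and let $T$ be an invertible linear map on $\mathbb{R}^d$. Then the condition $$T(\mathbb{Z}\alpha+\mathbb{Z}^d)=\mathbb{Z}\beta+\mathbb{Z}^d$$ is equivalent to the following one: for every bounded, measurable set $S$ in $\mathbb{R}^d$ (not necessarily Riemann measurable), $S$ is a bounded remainder set with respect to $\alpha$ if and only if its image $T(S)$ is a bounded remainder set with respect to $\beta$.
   Context: A vector $\alpha = (\alpha_1,\dots,\alpha_d) \in \mathbb{R}^d$ is called irrational if $1, \alpha_1, \ldots, \alpha_d$ are linearly independent over $\mathbb{Q}$. We write $\mathbb{Z}\alpha+\mathbb{Z}^d = \{ n\alpha + m : n \in \mathbb{Z}, m \in \mathbb{Z}^d\}$ and $\mathbb{T}^d = \mathbb{R}^d/\mathbb{Z}^d$. For a bounded measurable set $S \subset \mathbb{R}^d$ let $\chi_S(x) = \sum_{k \in \mathbb{Z}^d} \mathbf{1}_S(x+k)$, a $\mathbb{Z}^d$-periodic function regarded as a function on $\mathbb{T}^d$. A bounded measurable set $S \subset \mathbb{R}^d$ is a bounded remainder set (BRS) with respect to an irrational vector $\alpha$ if there is a constant $C = C(S,\alpha)$ such that for every $n \geq 1$ and almost every $x \in \mathbb{T}^d$, $\left| \sum_{k=0}^{n-1} \chi_S(x+k\alpha) - n \operatorname{mes} S \right| \leq C$, where $\operatorname{mes}$ is Lebesgue measure. A bounded set in $\mathbb{R}^d$ is Riemann measurable if its boundary has Lebesgue measure zero. *)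

(* Defs.v *)
From HB Require Import structures.
From mathcomp Require Import all_boot all_order all_algebra.
From mathcomp Require Import all_classical all_reals all_analysis.
Set Implicit Arguments.
Unset Strict Implicit.
Unset Printing Implicit Defensive.
Import Order.TTheory GRing.Theory Num.Theory.
Import numFieldNormedType.Exports.
Local Open Scope classical_set_scope.
Local Open Scope ring_scope.

(* MathComp-Analysis has no Lebesgue measure on R^d for general d.  It is set
   up here as the restriction of the Lebesgue outer measure (infimum of the
   total volume of countable covers by half-open boxes) to the sets that are
   measurable in the sense of Caratheodory. *)
Section Lebesgue.
Variables (R : realType) (d : nat).
Implicit Types (A : set 'rV[R]_d) (b : 'rV[R]_d * 'rV[R]_d).

Definition box b : set 'rV[R]_d :=
  [set x | forall i : 'I_d, b.1 ord0 i < x ord0 i <= b.2 ord0 i].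

Definition box_volume b : R :=
  \prod_(i < d) Num.max 0 (b.2 ord0 i - b.1 ord0 i).

Definition box_cover A : set (set ('rV[R]_d * 'rV[R]_d)) :=
  [set B | countable B /\ A `<=` \bigcup_(b in B) box b].

Definition lebesgue_outer A : \bar R :=
  ereal_inf [set (\esum_(b in B) (box_volume b)%:E)%E | B in box_cover A].

Lemma box_volume_ge0 b : 0 <= box_volume b.
Proof. by apply: prodr_ge0 => i _; rewrite le_max lexx. Qed.

Lemma lebesgue_outer_ge0 A : (0 <= lebesgue_outer A)%E.
Proof.
apply: le_ereal_inf_tmp => _ [B _ <-].
by apply: esum_ge0 => b _; rewrite lee_fin box_volume_ge0.
Qed.

Lemma lebesgue_outer0 : lebesgue_outer set0 = 0%E.
Proof.
apply/eqP; rewrite eq_le lebesgue_outer_ge0 andbT.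
apply: ereal_inf_lbound; exists set0; last by rewrite esum_set0.
by split; [exact: countable0 | exact: sub0set].
Qed.

Lemma le_lebesgue_outer : {homo lebesgue_outer : A B / A `<=` B >-> (A <= B)%E}.
Proof.
move=> A A' AA'; apply: ereal_inf_le_tmp => _ [B [cB A'B] <-].
by exists B => //; split => //; exact: subset_trans A'B.
Qed.

Lemma lebesgue_outer_sigma_subadditive : sigma_subadditive lebesgue_outer.
Proof.
move=> A; have [[i ioo]|] := pselect (exists i, lebesgue_outer (A i) = +oo%E).
  rewrite (eseries_pinfty _ _ ioo) ?leey// => n _.
  by rewrite -ltNye (lt_le_trans _ (lebesgue_outer_ge0 _)).
rewrite -forallNE => Aoo; apply/lee_addgt0Pr => _/posnumP[e].
rewrite (le_trans _ (epsilon_trick _ _ _))//; last first.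
  by move=> n; exact: lebesgue_outer_ge0.
pose vol (b : 'rV[R]_d * 'rV[R]_d) := (box_volume b)%:E.
have vol0 b : (0 <= vol b)%E by rewrite lee_fin box_volume_ge0.
pose P n (B : set ('rV[R]_d * 'rV[R]_d)) := box_cover (A n) B /\
  (\esum_(b in B) vol b <= lebesgue_outer (A n) +
                           (e%:num / (2 ^ n.+1)%:R)%:E)%E.
have [G PG] : {G : nat -> set ('rV[R]_d * 'rV[R]_d) & forall n, P n (G n)}.
  apply: (@choice _ _ P) => n.
  have en : 0 < e%:num / (2 ^ n.+1)%:R :> R by [].
  have fin : lebesgue_outer (A n) \is a fin_num.
    by rewrite ge0_fin_numE ?lebesgue_outer_ge0// ltey; apply/eqP; exact: Aoo.
  have [_ [B BA <-] Be] := lb_ereal_inf_adherent en fin.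
  by exists B; split => //; exact/ltW.
apply: (@le_trans _ _ (\esum_(b in \bigcup_n G n) vol b)%E).
  apply: ereal_inf_lbound; exists (\bigcup_n G n) => //; split.
    apply: bigcup_countable => [|n _]; first exact: countableP.
    exact: (PG n).1.1.
  move=> x [n _ /(PG n).1.2 [b Gb bx]].
  by exists b => //; exists n.
rewrite seqDU_bigcup_eq nneseries_sum_bigcup//.
apply: lee_nneseries => [n _ _|n _]; first by apply: esum_ge0 => b _.
apply: le_trans (PG n).2.
rewrite [leRHS](esumID (seqDU G n))// -[leLHS]adde0.
rewrite setIidr; last exact: subset_seqDU.
by apply: leeD => //; exact: esum_ge0.
Qed.

HB.instance Definition _ := isOuterMeasure.Build R 'rV[R]_d lebesgue_outer
  lebesgue_outer0 lebesgue_outer_ge0 le_lebesgue_outer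
  lebesgue_outer_sigma_subadditive.

Definition lebesgue_rV : set (caratheodory_type lebesgue_outer) -> \bar R :=
  lebesgue_outer.

HB.instance Definition _ := isMeasure.Build _ _ _ lebesgue_rV
  (@caratheodory_measure0 _ _ lebesgue_outer)
  (@caratheodory_measure_ge0 _ _ lebesgue_outer)
  (@caratheodory_measure_sigma_additive _ _ lebesgue_outer).

Definition lebesgue_measurable A : Prop := lebesgue_outer.-cara.-measurable A.

Definition mes A : R := fine (lebesgue_rV A).

End Lebesgue.

Section BoundedRemainderSets.
Variables (R : realType) (d : nat).
Implicit Types (alpha x : 'rV[R]_d) (S : set 'rV[R]_d).

Definition int_vec (m : 'rV[int]_d) : 'rV[R]_d := map_mx intr m.

Definition irrational_vec alpha : Prop :=
  forall (q0 : rat) (q : 'I_d -> rat),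
    ratr q0 + \sum_(i < d) ratr (q i) * alpha ord0 i = 0 ->
    q0 = 0 /\ forall i, q i = 0.

Definition Zspan alpha : set 'rV[R]_d :=
  [set x | exists (n : int) (m : 'rV[int]_d), x = alpha *~ n + int_vec m].

(* The sum over Z^d is a finitely supported one, as S is bounded wherever this
   is used (the library gives a sum with infinite support the value 0). *)
Definition chi S x : R :=
  \sum_(k \in [set: 'rV[int]_d]) (\1_S (x + int_vec k) : R).

(* Fundamental domain representing the torus R^d / Z^d: the measure of the torus
   is the Lebesgue measure of [0, 1[^d. *)
Definition torus_dom : set 'rV[R]_d :=
  [set x | forall i : 'I_d, 0 <= x ord0 i < 1].

Definition bounded_remainder alpha S : Prop :=
  [/\ bounded_set S, lebesgue_measurable S &
    exists C : R, forall n : nat, (1 <= n)%N ->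
      {ae @lebesgue_rV R d, forall x : 'rV[R]_d, torus_dom x ->
        `| \sum_(0 <= k < n) chi S (x + alpha *+ k) - n%:R * mes S | <= C}].

End BoundedRemainderSets.

(* Main.v *)
Require Import Defs.
From mathcomp Require Import all_boot all_order all_algebra.
From mathcomp Require Import all_classical all_reals all_analysis.
From mathcomp Require Import finmap measurable_realfun.
From mathcomp Require Import ring lra zify.
Set Implicit Arguments.
Unset Strict Implicit.
Unset Printing Implicit Defensive.
Import Order.TTheory GRing.Theory Num.Theory.
Import numFieldNormedType.Exports.
Local Open Scope classical_set_scope.
Local Open Scope ring_scope.

(** Why the equivalence holds.

    Suppose first that [T] carries [Z alpha + Z^d] onto [Z beta + Z^d]. Both
    groups are copies of [Z x Z^d], because the vectors are irrational, so [T]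
    induces a bijection of [Z x Z^d]; its first coordinate [n'] is an integral
    linear form in [(n, m)]. For an orbit point [s = x + n alpha + m] in a bounded
    set [S], the vector [m] equals [s - x - n alpha], whence [n' = c n + O(1)] with
    one constant [c], which irrationality makes nonzero. The orbit points of
    [T x] in [T S] with [0 <= n' < N] are therefore those of [x] in [S] with [n] in
    a window of length [N / |c|], up to bounded ends, and their number is
    [N mes S / |c| + O(1)] (bounded_remainder_matrix). As the mean of
    [chi (T S)] over the torus is the measure of [T S], a bound of this shape
    forces [mes (T S) = mes S / |c|] (bounded_remainder_mean). It remains
    that [T S] is measurable and that [T] preserves null sets, which follows from
    covers by small cubes and from a hull of [S] built of boxes
    (measurable_linear_preimage).

    Conversely suppose that [T] preserves bounded remainder sets and that some
    [g] in [Z alpha + Z^d] has [delta = T g] outside [Z beta + Z^d]. Let [B0] be a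
    union of integer translates of the unit cell, and exchange an arbitrary
    measurable part [A0] of it for the translate [A0 + g], taken so far away that
    it is disjoint from [B0]. As [g] lies in the group, the Birkhoff sums of [A0]
    and of [A0 + g] differ by a bounded telescoping sum, so the result is again a
    bounded remainder set. Its image says that the Birkhoff sums of [E = T A0] and
    of [E + delta] along [beta] differ boundedly, for every measurable [E] in the
    unit cell. This is absurd (exists_unbounded_set): no point [k beta]
    coincides with a point [l beta - delta] on the torus, so at stage [j] one can decree
    that [E] contains small cubes at the points [l beta - delta] with [l < j] and
    avoids those at [l beta]; if the cubes shrink fast enough, the decrees of the
    later stages spoil those of stage [j] only on a small part of a cube, and
    elsewhere on that cube the difference of the sums equals [j]. The inverse map
    gives the other inclusion. *)

(** * Countable families of sets *)

Section OuterMeasure.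
Variables (R : realType) (d : nat).
Implicit Types (A B X : set 'rV[R]_d) (b : 'rV[R]_d * 'rV[R]_d) (v x : 'rV[R]_d).

Local Notation mu := (@lebesgue_outer R d).
Local Notation M := (@lebesgue_measurable R d).

Lemma lebesgue_measurableP A :
  M A <-> forall X, (mu (X `&` A) + mu (X `&` ~` A) <= mu X)%E.
Proof.
split=> [mA X|]; last exact: le_caratheodory_measurable.
by rewrite -(mA X).
Qed.

(** A set is the union of the fibres of a code in [nat]; if the code is injective
    each fibre has at most one point, which reduces countable families to
    sequences. *)
Lemma outer_bigcup_fiber (I : choiceType) (D : set I) (e : I -> nat) :
  \bigcup_n [set i | D i /\ e i = n] = D.
Proof. by apply/seteqP; split=> [i [n _ []//]|i Di]; exists (e i). Qed.

Lemma fiber_inj (I : choiceType) (D : set I) (e : I -> nat) n :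
  {in D &, injective e} ->
  [set i | D i /\ e i = n] = set0 \/
  exists2 i, D i & [set i | D i /\ e i = n] = [set i].
Proof.
move=> einj; have [->|] := eqVneq [set i | D i /\ e i = n] set0; first by left.
move=> /set0P[i [Di ein]]; right; exists i => //.
apply/seteqP; split=> [j [Dj ejn]|j ->//].
by apply: einj; [exact: mem_set | exact: mem_set | rewrite ejn].
Qed.

Lemma outer_bigcup (I : choiceType) (D : set I) (F : I -> set 'rV[R]_d) :
  countable D ->
  (mu (\bigcup_(i in D) F i) <= \esum_(i in D) mu (F i))%E.
Proof.
move=> /countable_injP[e einj].
rewrite -[D in leRHS](outer_bigcup_fiber D e) nneseries_sum_bigcup; last first.
- by move=> i; exact: lebesgue_outer_ge0.
- by move=> m n _ _ [i [[_ <-] [_ <-]]].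
rewrite -[D in leLHS](outer_bigcup_fiber D e) bigcup_bigcup.
apply: le_trans (lebesgue_outer_sigma_subadditive _) _.
apply: lee_nneseries => [n _ _|n _]; first exact: lebesgue_outer_ge0.
have [->|[i _ ->]] := fiber_inj n einj.
  by rewrite bigcup_set0 lebesgue_outer0 esum_ge0// => i _; exact: lebesgue_outer_ge0.
by rewrite bigcup_set1 esum_set1// lebesgue_outer_ge0.
Qed.

Lemma outer_bigcup_trivIset (I : choiceType) (D : set I) (F : I -> set 'rV[R]_d) :
  countable D -> (forall i, D i -> M (F i)) -> trivIset D F ->
  (mu (\bigcup_(i in D) F i) = \esum_(i in D) mu (F i))%E.
Proof.
move=> /countable_injP[e einj] mF tF.
rewrite -[D in RHS](outer_bigcup_fiber D e) nneseries_sum_bigcup; last first.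
- by move=> i; exact: lebesgue_outer_ge0.
- by move=> m n _ _ [i [[_ <-] [_ <-]]].
rewrite -[D in LHS](outer_bigcup_fiber D e) bigcup_bigcup.
have mJ n : setT n -> M (\bigcup_(i in [set i | D i /\ e i = n]) F i).
  move=> _; have [->|[i Di ->]] := fiber_inj n einj.
    by rewrite bigcup_set0; exact: measurable0.
  by rewrite bigcup_set1; exact: mF.
have tJ : trivIset setT (fun n => \bigcup_(i in [set i | D i /\ e i = n]) F i).
  move=> m n _ _ [x [[i [Di <-] Fix] [j [Dj <-] Fjx]]].
  by congr e; apply: tF => //; exists x.
apply: etrans (measure_bigcup (@lebesgue_rV R d) setT _ mJ tJ) _.
rewrite (eq_eseriesl (Q := xpredT)); last by move=> n; exact: mem_setT.
apply: eq_eseriesr => n _.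
rewrite -[LHS]/(mu _); have [->|[i _ ->]] := fiber_inj n einj.
  by rewrite bigcup_set0 esum_set0 lebesgue_outer0.
by rewrite bigcup_set1 esum_set1// lebesgue_outer_ge0.
Qed.

Lemma outerU A B : (mu (A `|` B) <= mu A + mu B)%E.
Proof.
rewrite -bigcup2E; apply: le_trans (lebesgue_outer_sigma_subadditive _) _.
rewrite (nneseries_split 0 2)//=; last by move=> k _; exact: lebesgue_outer_ge0.
rewrite add0n big_mkord !big_ord_recl big_ord0 /= adde0.
rewrite eseries0 ?adde0// => -[//|[//|n]] _ _ /=; exact: lebesgue_outer0.
Qed.

Lemma esum_mulr_le (I : choiceType) (D : set I) (a : I -> \bar R) (K : R) :
  0 < K -> (forall i, 0 <= a i)%E ->
  (\esum_(i in D) (K%:E * a i) <= K%:E * \esum_(i in D) a i)%E.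
Proof.
move=> K0 a0; apply: ge_ereal_sup => _ [F [finF FD] <-].
rewrite -ge0_mule_fsumr//; apply: lee_wpmul2l; first by rewrite lee_fin ltW.
by apply: esum_ge; exists F.
Qed.

(** Boxes suffice to test how a map distorts the outer measure, since a cover of
    [A] by boxes is carried to a cover of [f @` A] by their images. *)
Lemma outer_image_le (f : 'rV[R]_d -> 'rV[R]_d) (K : R) : 0 < K ->
  (forall b, (mu (f @` box b) <= (K * box_volume b)%:E)%E) ->
  forall A, (mu (f @` A) <= K%:E * mu A)%E.
Proof.
move=> K0 fK A; rewrite -lee_pdivrMl//.
apply: le_ereal_inf_tmp => _ [B [cB AB] <-]; rewrite lee_pdivrMl//.
apply: (@le_trans _ _ (\esum_(b in B) mu (f @` box b))).
  apply: le_trans (outer_bigcup _ cB); apply: le_lebesgue_outer.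
  by move=> _ [x /AB[b Bb bx] <-]; exists b => //; exists x.
apply: le_trans (esum_mulr_le _ K0 _); last first.
  by move=> b; rewrite lee_fin box_volume_ge0.
by apply: le_esum => b _; rewrite -EFinM; exact: fK.
Qed.

End OuterMeasure.

(** * Boxes, half-spaces and translations *)

(** The side of a box is [Num.max 0 (q - p)], which is additive under a cut at [a]
    even when the side is degenerate or [a] lies outside of it. *)
Lemma maxr0_split (R : realDomainType) (a p q : R) :
  Num.max 0 (q - p) =
  Num.max 0 (q - Num.max a p) + Num.max 0 (Num.min a q - p).
Proof.
rewrite !maxEle !minEle; case: (leP a p); case: (leP a q); do !case: ifP; lra.
Qed.

Section Boxes.
Variables (R : realType) (d : nat).
Implicit Types (A B X : set 'rV[R]_d) (b : 'rV[R]_d * 'rV[R]_d) (v x : 'rV[R]_d).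

Local Notation mu := (@lebesgue_outer R d).
Local Notation M := (@lebesgue_measurable R d).

Lemma outer_box_le b : (mu (box b) <= (box_volume b)%:E)%E.
Proof.
apply: ereal_inf_lbound; exists [set b].
  by split; [exact: countable1 | rewrite bigcup_set1].
by rewrite esum_set1// lee_fin box_volume_ge0.
Qed.

Lemma outer_shift_le v A : (mu [set x | A (x + v)%R] <= mu A)%E.
Proof.
have -> : [set x : 'rV[R]_d | A (x + v)] = (fun x => x - v) @` A.
  apply/seteqP; split=> [x Ax|_ [x Ax <-]]; last by rewrite /= subrK.
  by exists (x + v); rewrite // addrK.
rewrite -[leRHS]mul1e; apply: outer_image_le => // b; rewrite mul1r.
have -> : box_volume b = box_volume (b.1 - v, b.2 - v).
  by apply: eq_bigr => i _; rewrite !mxE; congr Num.max; ring.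
apply: le_trans (outer_box_le _); apply: le_lebesgue_outer.
by move=> _ [x bx <-] i; rewrite !mxE ltrD2r lerD2r; exact: bx.
Qed.

Lemma outer_shift v A : mu [set x | A (x + v)] = mu A.
Proof.
apply/eqP; rewrite eq_le outer_shift_le/=.
apply: le_trans (outer_shift_le (- v) _); apply: le_lebesgue_outer => x Ax /=.
by rewrite subrK.
Qed.

Lemma measurable_shift v A : M A -> M [set x : 'rV[R]_d | A (x + v)].
Proof.
move=> mA; apply/lebesgue_measurableP => X.
rewrite -(outer_shift (- v) X) -(outer_shift (- v) (X `&` _))
  -(outer_shift (- v) (X `&` ~` _)).
have /lebesgue_measurableP := mA => /(_ [set x | X (x - v)]); apply: le_trans.
by apply: leeD; apply: le_lebesgue_outer => x [] /=; rewrite subrK.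
Qed.

(** A hyperplane orthogonal to an axis cuts each box of a cover into two boxes
    without changing the total volume. *)
Lemma measurable_halfspace (i : 'I_d) (a : R) : M [set x : 'rV[R]_d | a < x ord0 i].
Proof.
apply/lebesgue_measurableP => X; apply: le_ereal_inf_tmp => _ [B [cB XB] <-].
pose up b : 'rV[R]_d * 'rV[R]_d :=
  (\row_j (if j == i then Num.max a (b.1 ord0 i) else b.1 ord0 j), b.2).
pose dn b : 'rV[R]_d * 'rV[R]_d :=
  (b.1, \row_j (if j == i then Num.min a (b.2 ord0 i) else b.2 ord0 j)).
have volE b : box_volume b = box_volume (up b) + box_volume (dn b).
  rewrite /box_volume (bigD1 i)// [in RHS](bigD1 i)//=.
  rewrite [X in _ = _ + X](bigD1 i)//= !mxE eqxx.
  rewrite [X in _ = _ * X + _](eq_bigr (fun j => Num.max 0 (b.2 ord0 j - b.1 ord0 j))); last first.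
    by move=> j /negbTE ji; rewrite !mxE ji.
  rewrite [X in _ = _ + _ * X](eq_bigr (fun j => Num.max 0 (b.2 ord0 j - b.1 ord0 j))); last first.
    by move=> j /negbTE ji; rewrite !mxE ji.
  rewrite -mulrDl; congr (_ * _).
  exact: maxr0_split.
rewrite (eq_esum (b := fun b => ((box_volume (up b))%:E + (box_volume (dn b))%:E)%E)); last first.
  by move=> b _; rewrite volE.
rewrite esumD; last 2 first.
- by move=> b _; rewrite lee_fin box_volume_ge0.
- by move=> b _; rewrite lee_fin box_volume_ge0.
have le_esum_box (f : 'rV[R]_d * 'rV[R]_d -> 'rV[R]_d * 'rV[R]_d) Y :
    Y `<=` \bigcup_(b in B) box (f b) ->
    (mu Y <= \esum_(b in B) (box_volume (f b))%:E)%E.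
  move=> YB; apply: le_trans (le_lebesgue_outer YB) _.
  apply: le_trans (outer_bigcup _ cB) _.
  by apply: le_esum => b _; exact: outer_box_le.
apply: leeD; apply: le_esum_box => x [/XB[b Bb bx]] /=.
  move=> ax; exists b => // j; rewrite !mxE; case: eqP => [->|_]; last exact: bx.
  by rewrite gt_max ax; exact: bx.
move=> /negP; rewrite -leNgt => xa; exists b => // j; rewrite !mxE.
case: eqP => [->|_]; last exact: bx.
by rewrite le_min xa; exact: bx.
Qed.

Lemma measurable_bigcup_countable (I : choiceType) (D : set I)
    (F : I -> set 'rV[R]_d) :
  countable D -> (forall i, D i -> M (F i)) -> M (\bigcup_(i in D) F i).
Proof.
move=> /countable_injP[e einj] mF.
rewrite -[D](outer_bigcup_fiber D e) bigcup_bigcup.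
apply: bigcupT_measurable => n; have [->|[i Di ->]] := fiber_inj n einj.
  by rewrite bigcup_set0; exact: measurable0.
by rewrite bigcup_set1; exact: mF.
Qed.

(** Coordinates are measurable because half-spaces are; linear functionals are
    sums of multiples of coordinates. *)
Lemma measurable_linear_lt (A : 'M[R]_d) (i : 'I_d) (a : R) :
  M [set x : 'rV[R]_d | a < (x *m A) ord0 i].
Proof.
pose L := caratheodory_type mu.
have mcoord (j : 'I_d) : measurable_fun [set: L] (fun x : L => (x : 'rV[R]_d) ord0 j).
  apply: (measurability _ (RGenOInfty.measurableE R)) => // _ [_ [r ->] <-].
  rewrite setTI; have -> : (fun x : L => (x : 'rV[R]_d) ord0 j) @^-1` `]r, +oo[%classic
     = [set x : 'rV[R]_d | r < x ord0 j].
    by apply/seteqP; split=> x /=; rewrite in_itv/= andbT.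
  exact: measurable_halfspace.
have mf : measurable_fun [set: L] (fun x : L => ((x : 'rV[R]_d) *m A) ord0 i).
  under eq_fun do rewrite mxE.
  apply: measurable_sum => j; apply: measurable_funM => //.
have := mf measurableT `]a, +oo[%classic (measurable_itv _).
rewrite setTI.
suff -> : (fun x : L => ((x : 'rV[R]_d) *m A) ord0 i) @^-1` `]a, +oo[%classic
  = [set x : 'rV[R]_d | a < (x *m A) ord0 i] by [].
by apply/seteqP; split=> x /=; rewrite in_itv/= andbT.
Qed.

Lemma measurable_linear_le (A : 'M[R]_d) (i : 'I_d) (a : R) :
  M [set x : 'rV[R]_d | (x *m A) ord0 i <= a].
Proof.
have -> : [set x : 'rV[R]_d | (x *m A) ord0 i <= a] = ~` [set x | a < (x *m A) ord0 i].
  by apply/seteqP; split=> x /=; rewrite leNgt => /negP.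
by apply: measurableC; exact: measurable_linear_lt.
Qed.

Lemma measurable_linear_box (A : 'M[R]_d) b : M [set x : 'rV[R]_d | box b (x *m A)].
Proof.
have -> : [set x : 'rV[R]_d | box b (x *m A)] = \bigcap_(i in [set: 'I_d])
   ([set x | b.1 ord0 i < (x *m A) ord0 i] `&`
    [set x | (x *m A) ord0 i <= b.2 ord0 i]).
  apply/seteqP; split=> [x bx i _ /=|x bx i].
    by have /andP[] := bx i.
  by have [/= -> ->] := bx i I.
apply: fin_bigcap_measurable => [|i _]; first exact: finite_finset.
apply: measurableI.
  exact: measurable_linear_lt.
exact: measurable_linear_le.
Qed.

Lemma measurable_coord_le (i : 'I_d) a : M [set x : 'rV[R]_d | x ord0 i <= a].
Proof.
have := measurable_linear_le 1%:M i a.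
suff -> : [set x : 'rV[R]_d | (x *m 1%:M) ord0 i <= a] = [set x | x ord0 i <= a] by [].
by apply/seteqP; split=> x /=; rewrite mulmx1.
Qed.

Lemma measurable_coord_ge (i : 'I_d) a : M [set x : 'rV[R]_d | a <= x ord0 i].
Proof.
have := measurable_linear_le (- 1%:M) i (- a).
suff -> : [set x : 'rV[R]_d | (x *m - 1%:M) ord0 i <= - a] = [set x | a <= x ord0 i] by [].
by apply/seteqP; split=> x /=; rewrite mulmxN mulmx1 mxE lerN2.
Qed.

Lemma measurable_coord_lt (i : 'I_d) a : M [set x : 'rV[R]_d | x ord0 i < a].
Proof.
have -> : [set x : 'rV[R]_d | x ord0 i < a] = ~` [set x | a <= x ord0 i].
  by apply/seteqP; split=> x /=; rewrite ltNge => /negP.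
by apply: measurableC; exact: measurable_coord_ge.
Qed.

Lemma measurable_null A : mu A = 0%E -> M A.
Proof.
move=> A0; apply/lebesgue_measurableP => X.
have -> : mu (X `&` A) = 0%E.
  apply/eqP; rewrite eq_le lebesgue_outer_ge0 andbT -A0.
  by apply: le_lebesgue_outer => x [].
by rewrite add0e; apply: le_lebesgue_outer => x [].
Qed.

End Boxes.

(** * Null sets under linear maps *)

Lemma fin_pos_lb (R : realFieldType) (I : finType) (f : I -> R) :
  (forall i, 0 < f i) -> exists2 s : R, 0 < s & forall i, s <= f i.
Proof.
move=> f0; exists (\big[Num.min/1]_i f i); first exact: lt_bigmin.
by move=> i; exact: bigmin_le.
Qed.

Lemma card_ffun_family (d N : nat) (P : 'I_d -> pred 'I_N) :
  #|[pred f : {ffun 'I_d -> 'I_N} | [forall i, P i (f i)]]| =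
  (\prod_i #|P i|)%N.
Proof.
transitivity #|(family P : simpl_pred {ffun 'I_d -> 'I_N})|.
  by apply: eq_card => f; rewrite !inE.
by rewrite card_family foldrE big_image.
Qed.

Section LinearImage.
Variables (R : realType) (d : nat).
Implicit Types (A B X : set 'rV[R]_d) (b : 'rV[R]_d * 'rV[R]_d) (v x : 'rV[R]_d).

Local Notation mu := (@lebesgue_outer R d).
Local Notation M := (@lebesgue_measurable R d).

Lemma outer_fin_bigcup_le (I : finType) (P : pred I) (F : I -> set 'rV[R]_d) (c : R) :
  (forall i, P i -> (mu (F i) <= c%:E)%E) ->
  (mu (\bigcup_(i in [set i | P i]) F i) <= (#|P|%:R * c)%:E)%E.
Proof.
move=> Fc; apply: le_trans (outer_bigcup _ (countableP _)) _.
rewrite esum_fset; last 2 first.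
- exact: finite_finset.
- by move=> i _; exact: lebesgue_outer_ge0.
apply: (@le_trans _ _ (\sum_(i \in [set i | P i]) c%:E)%E).
  by apply: lee_fsum => [|i Pi]; [exact: finite_finset|exact: Fc].
rewrite (fsbigE (enum P)) ?enum_uniq//=; last 2 first.
- by move=> i /=; rewrite mem_enum.
- by move=> i Pi; rewrite mem_enum unfold_in Pi.
rewrite big_rmcond_in; last by move=> i; rewrite mem_enum => Pi /negP[]; exact: mem_set.
by rewrite sumEFin big_const_seq count_predT iter_addr_0 -cardE mulr_natl.
Qed.

Lemma mulmx_coord_le (A : 'M[R]_d) (s : R) x :
  (forall j, `|x ord0 j| <= s) ->
  forall i, `|(x *m A) ord0 i| <= (\sum_i \sum_j `|A j i|) * s.
Proof.
move=> xs i; rewrite mxE.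
have s0 : 0 <= s by exact: le_trans (xs i).
apply: le_trans (ler_norm_sum _ _ _) _.
rewrite [X in _ <= X * _](bigD1 i)//= mulrDl ler_wpDr//.
  by rewrite mulr_ge0// sumr_ge0// => k _; rewrite sumr_ge0.
rewrite mulr_suml ler_sum// => j _.
by rewrite normrM mulrC ler_wpM2l.
Qed.

(** A box is cut into nearly cubical pieces with side at most its shortest side.
    The image of a small cube lies in a cube of proportional size, whereas the
    image of the whole box may be far larger than its volume suggests. *)
Lemma outer_linear_box (A : 'M[R]_d) :
  exists2 K : R, 0 < K & forall b,
    (mu ((fun x => x *m A) @` box b) <= (K * box_volume b)%:E)%E.
Proof.
pose K1 : R := \sum_i \sum_j `|A j i| + 1.
have K1_gt0 : 0 < K1.
  by rewrite ltr_wpDl// sumr_ge0// => k _; rewrite sumr_ge0.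
exists ((8 * K1) ^+ d) => [|b]; first by rewrite exprn_gt0// mulr_gt0.
pose l i := b.2 ord0 i - b.1 ord0 i.
have [l_gt0|] := pselect (forall i, 0 < l i); last first.
  move=> /existsNP[i /negP]; rewrite -leNgt => li.
  have -> : box b = set0.
    apply/seteqP; split=> // x /(_ i) /andP[x1 x2].
    by move: li; rewrite /l subr_le0 leNgt (lt_le_trans x1 x2).
  by rewrite image_set0 lebesgue_outer0 lee_fin mulr_ge0 ?box_volume_ge0// exprn_ge0// mulr_ge0// ltW.
have [s s_gt0 sl] := fin_pos_lb l_gt0.
(* As [s <= l i], rounding [l i / s] up at most doubles it. *)
pose n i := (Num.trunc (l i / s)).+1.
pose N := \max_i n i.
have nN i : (n i <= N)%N by exact: leq_bigmax.
pose P i : pred 'I_N.+1 := fun k => (k < n i)%N.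
pose c (f : {ffun 'I_d -> 'I_N.+1}) : 'rV[R]_d :=
  \row_i (b.1 ord0 i + s * (f i)%:R).
pose Q f := box (c f *m A - const_mx (2 * K1 * s), c f *m A + const_mx (2 * K1 * s)).
apply: (@le_trans _ _ (mu (\bigcup_(f in [set f : {ffun 'I_d -> 'I_N.+1} |
    [forall i, P i (f i)]]) Q f))).
  apply: le_lebesgue_outer => _ [x bx <-].
  pose k i := Num.trunc ((x ord0 i - b.1 ord0 i) / s).
  have t_ge0 i : 0 <= (x ord0 i - b.1 ord0 i) / s.
    by have /andP[/ltW ? _] := bx i; rewrite divr_ge0 ?subr_ge0// ltW.
  have kn i : (k i < n i)%N.
    rewrite ltnS truncn_le_nat; apply: le_lt_trans (truncnS_gt _).
    rewrite ler_pM2r ?invr_gt0//.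
    by have /andP[_ ?] := bx i; rewrite lerD2r.
  exists [ffun i => inord (k i)] => /=.
    apply/forallP => i; rewrite ffunE /P inordK ?kn//.
    by rewrite ltnS (leq_trans (ltnW (kn i))).
  have dist i : `|(x - c [ffun i => inord (k i)]) ord0 i| <= s.
    rewrite !mxE ffunE inordK; last by rewrite ltnS (leq_trans (ltnW (kn i))).
    have /andP[] := truncn_itv (t_ge0 i); rewrite -/(k i).
    rewrite ler_pdivlMr// ltr_pdivrMr// -natr1 => h1 h2.
    by rewrite ler_norml; apply/andP; split; nra.
  move=> i /=.
  have := mulmx_coord_le A dist i; rewrite mulmxBl mxE [X in _ + X]mxE.
  have : (\sum_i \sum_j `|A j i|) * s < 2 * K1 * s.
    by rewrite ltr_pM2r// /K1; move: K1_gt0; rewrite /K1; lra.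
  rewrite !mxE ler_norml => h /andP[h1 h2].
  by apply/andP; split; lra.
apply: le_trans (outer_fin_bigcup_le (c := (4 * K1 * s) ^+ d) _) _.
  move=> f _; apply: le_trans (outer_box_le _) _; rewrite lee_fin.
  rewrite /box_volume -[X in _ ^+ X]card_ord -prodr_const.
  apply: ler_prod => i _; rewrite le_max lexx /= !mxE ge_max.
  rewrite [X in _ && (X <= _)](_ : _ = 4 * K1 * s); last by ring.
  by rewrite lexx andbT !mulr_ge0// ltW.
rewrite lee_fin (_ : #|_| = (\prod_i #|P i|)%N); last exact: card_ffun_family.
rewrite natr_prod -[X in (4 * _ * _) ^+ X]card_ord -[X in (8 * _) ^+ X]card_ord.
rewrite -!prodr_const -!big_split /=; apply: ler_prod => i _.
rewrite mulr_ge0 ?ler0n//=; last by rewrite !mulr_ge0// ltW.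
rewrite max_r; last exact/ltW/l_gt0.
rewrite -/(l i).
have -> : #|P i| = n i.
  rewrite -sum1_card (eq_bigl (fun k : 'I_N.+1 => (k < n i)%N))//.
  by rewrite (big_ord_narrow (leqW (nN i))) sum1_card card_ord.
have h : (n i)%:R <= 2 * (l i / s).
  have /andP[h _] := truncn_itv (ltW (divr_gt0 (l_gt0 i) s_gt0)).
  rewrite /n -natr1; apply: le_trans (lerD h (lexx _)) _.
  by have := sl i; rewrite -[s in s <= _]mul1r -ler_pdivlMr//; lra.
have -> : 8 * K1 * l i = (2 * (l i / s)) * (4 * K1 * s) by field; lra.
by apply: ler_wpM2r => //; rewrite !mulr_ge0// ltW.
Qed.

Lemma outer_linear_null (A : 'M[R]_d) B :
  mu B = 0%E -> mu ((fun x => x *m A) @` B) = 0%E.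
Proof.
move=> B0; have [K K0 /(outer_image_le K0)/(_ B)] := outer_linear_box A.
rewrite B0 mule0 => h; apply/eqP; rewrite eq_le h.
exact: lebesgue_outer_ge0.
Qed.

End LinearImage.

(** * Measurability of linear images *)

Section LinearPreimage.
Variables (R : realType) (d : nat).
Implicit Types (A : 'M[R]_d) (S : set 'rV[R]_d).

Local Notation mu := (@lebesgue_outer R d).
Local Notation M := (@lebesgue_measurable R d).

(** Intersect covers of [S] by boxes whose total volumes approach [mu S]. *)
Lemma Gdelta_hull S : (mu S < +oo)%E ->
  exists2 B : nat -> set ('rV[R]_d * 'rV[R]_d),
    forall n, countable (B n) &
    S `<=` \bigcap_n \bigcup_(b in B n) box b /\
    (mu (\bigcap_n \bigcup_(b in B n) box b) <= mu S)%E.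
Proof.
move=> Sfin; pose P (n : nat) (B : set ('rV[R]_d * 'rV[R]_d)) := box_cover S B /\
  (\esum_(b in B) (box_volume b)%:E <= mu S + (n.+1%:R^-1)%:E)%E.
have [B PB] : {B : nat -> set ('rV[R]_d * 'rV[R]_d) & forall n, P n (B n)}.
  apply: (@choice _ _ P) => n.
  have fin : mu S \is a fin_num by rewrite ge0_fin_numE ?lebesgue_outer_ge0.
  have n0 : 0 < n.+1%:R^-1 :> R by rewrite invr_gt0.
  have [_ [B BS <-] Be] := lb_ereal_inf_adherent n0 fin.
  by exists B; split => //; exact/ltW.
exists B; first by move=> n; have [[]] := PB n.
split; first by move=> x Sx n _; have [[_ SB] _] := PB n; exact: SB.
apply/lee_addgt0Pr => e e0.
pose n := Num.trunc e^-1.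
apply: (@le_trans _ _ (mu S + (n.+1%:R^-1)%:E)%E); last first.
  rewrite leeD2l// lee_fin invf_ple ?posrE//.
  by apply: ltW; exact: truncnS_gt.
have [[cB _]] := PB n; apply: le_trans.
apply: (@le_trans _ _ (mu (\bigcup_(b in B n) box b))).
  by apply: le_lebesgue_outer => x; exact.
apply: le_trans (outer_bigcup _ cB) _.
by apply: le_esum => b _; exact: outer_box_le.
Qed.

(** A measurable set differs from its hull by a null set, and both behave well
    under a linear automorphism: the hull because boxes are cut out by linear
    inequalities, the null set because linear maps are Lipschitz. *)
Lemma measurable_linear_preimage A A' S : A *m A' = 1%:M -> A' *m A = 1%:M ->
  (mu S < +oo)%E -> M S -> M [set y : 'rV[R]_d | S (y *m A)].
Proof.
move=> AA' A'A Sfin mS; have [B cB [SB muB]] := Gdelta_hull Sfin.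
set H := \bigcap_n _ in SB muB.
have mBox (C : 'M[R]_d) n : M [set y : 'rV[R]_d | (\bigcup_(b in B n) box b) (y *m C)].
  have -> : [set y : 'rV[R]_d | (\bigcup_(b in B n) box b) (y *m C)] =
    \bigcup_(b in B n) [set y : 'rV[R]_d | box b (y *m C)] by [].
  by apply: measurable_bigcup_countable => // b _; exact: measurable_linear_box.
have mH C : M [set y : 'rV[R]_d | H (y *m C)].
  have -> : [set y : 'rV[R]_d | H (y *m C)] =
      \bigcap_n [set y : 'rV[R]_d | (\bigcup_(b in B n) box b) (y *m C)] by [].
  by apply: bigcapT_measurable => n; exact: mBox.
have HS0 : mu (H `\` S) = 0%E.
  have := mS H; rewrite (setIidr SB) -setDE => HE.
  have fin : mu S \is a fin_num by rewrite ge0_fin_numE ?lebesgue_outer_ge0.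
  move: muB; rewrite HE -[leRHS]adde0 leeD2lE// => h.
  by apply/eqP; rewrite eq_le h lebesgue_outer_ge0.
have -> : [set y : 'rV[R]_d | S (y *m A)] =
    [set y : 'rV[R]_d | H (y *m A)] `\` ((fun x => x *m A') @` (H `\` S)).
  apply/seteqP; split=> [y Sy|y [/= Hy]].
    split; first exact: SB.
    by move=> [x [_ nSx] xy]; apply: nSx; rewrite -(mulmx1 x) -A'A mulmxA xy.
  move=> nimg; apply: contrapT => nSy; apply: nimg; exists (y *m A) => //.
  by rewrite -mulmxA AA' mulmx1.
apply: measurableD; first exact: mH.
by apply: measurable_null; exact: outer_linear_null.
Qed.

End LinearPreimage.

(** * The measure of a cube *)

Lemma bernoulli_sub (R : realDomainType) (e : R) n :
  0 <= e <= 1 -> 1 - n%:R * e <= (1 - e) ^+ n.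
Proof.
move=> /andP[e0 e1]; elim: n => [|n IHn]; first by rewrite mul0r subr0 expr0.
rewrite exprS -natr1; have n0 : 0 <= n%:R :> R by [].
have : (1 - e) * (1 - n%:R * e) <= (1 - e) * (1 - e) ^+ n.
  by rewrite ler_wpM2l// subr_ge0.
have ne0 : 0 <= n%:R * (e * e) by rewrite !mulr_ge0.
by apply: le_trans; lra.
Qed.

Section CubeMeasure.
Variables (R : realType) (d : nat).
Implicit Types (b : 'rV[R]_d * 'rV[R]_d).

Local Notation mu := (@lebesgue_outer R d).
Local Notation M := (@lebesgue_measurable R d).

Definition cube (r : R) : set 'rV[R]_d :=
  [set x | forall i, 0 <= x ord0 i <= r].

(** The open interval is [w] long, so after subtraction of the floor of [a] its
    integer points are distinct naturals below [w]. *)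
Lemma count_grid_le (N : nat) (a w : R) : 0 <= w ->
  #|[pred k : 'I_N | a < k%:R < a + w]|%:R <= w + 1.
Proof.
move=> w0; pose z (k : 'I_N) : int := (k : int) - Num.floor a - 1.
have zE (k : 'I_N) : a < k%:R < a + w -> 0 <= z k /\ (`|z k|%N < (Num.trunc w).+1)%N.
  move=> /andP[ak ka].
  have z0 : 0 <= z k by rewrite /z -addrA -opprD subr_ge0 -ltzD1 ltrD2r floor_lt_int.
  split => //; rewrite -(ltr_nat R); apply: lt_trans (truncnS_gt w).
  rewrite natr_absz ger0_norm// /z !intrB.
  by have := floorD1_gt a; rewrite intrD; move: ka; lra.
pose f (k : 'I_N) : 'I_(Num.trunc w).+1 := inord `|z k|%N.
have finj : {in [pred k : 'I_N | a < k%:R < a + w] &, injective f}.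
  move=> j k /zE[zj0 zj] /zE[zk0 zk] /(congr1 val); rewrite /f /= !inordK// => jk.
  apply/val_inj/eqP; rewrite -eqz_nat.
  have : z j = z k by rewrite -(gez0_abs zj0) -(gez0_abs zk0) jk.
  by move=> /addIr/addIr ->.
rewrite -(card_in_image finj); apply: le_trans (_ : (Num.trunc w).+1%:R <= _).
  by rewrite ler_nat -[leqRHS]card_ord max_card.
by rewrite -natr1 lerD2r truncn_le.
Qed.

(** Inside a cube with side [r], the points of a grid with mesh [r / N] cannot be
    covered by boxes of total volume much below [r ^+ d], because a box of
    volume [v] contains about [N ^ d * v / r ^+ d] of them. *)
Lemma outer_cube_ge (r : R) : 0 < r ->
  ((r ^+ d)%:E <= mu (cube r))%E.
Proof.
move=> r0; apply: le_ereal_inf_tmp => _ [B [cB CB] <-].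
(* The factor [m] absorbs both the enlargement of the boxes to open sets and the
   rounding in the count of grid points; it then tends to 1. *)
suff approx (m : R) : 0 < m < 1 ->
    ((r ^+ d * m ^+ (d + d))%:E <= \esum_(b in B) (box_volume b)%:E)%E.
  apply/lee_addgt0Pr => e e0; set K := r ^+ d * (d + d)%:R.
  have K0 : 0 <= K by rewrite mulr_ge0// exprn_ge0// ltW.
  pose h := Num.min 2^-1 (e / (K + 1)).
  have h0 : 0 < h by rewrite lt_min invr_gt0 divr_gt0// ltr_wpDl.
  have h2 : h <= 2^-1 by rewrite ge_min lexx.
  have Kh : K * h <= e.
    apply: (@le_trans _ _ (K * (e / (K + 1)))).
      by rewrite ler_wpM2l// ge_min lexx orbT.
    by rewrite mulrCA ger_pMr// ler_pdivrMr ?mul1r ?lerDl// ltr_wpDl.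
  have m01 : 0 < 1 - h < 1 by lra.
  apply: (@le_trans _ _ ((r ^+ d * (1 - h) ^+ (d + d))%:E + e%:E)%E); last first.
    by rewrite leeD2r// approx.
  rewrite -EFinD lee_fin -lerBlDr.
  apply: (@le_trans _ _ (r ^+ d * (1 - (d + d)%:R * h))).
    by rewrite mulrBr mulr1 mulrA lerD2l lerN2.
  rewrite ler_wpM2l ?exprn_ge0 ?(ltW r0)// bernoulli_sub//; lra.
move=> /andP[m0 m1].
pose l b i := b.2 ord0 i - b.1 ord0 i.
pose O b := [set x : 'rV[R]_d | forall i, b.1 ord0 i < x ord0 i < b.1 ord0 i + l b i / m].
have oO b : B b -> open (O b).
  move=> _; rewrite openE => x Ox; apply: (@filter_forall _ _
    (fun i (y : 'rV[R]_d) => b.1 ord0 i < y ord0 i < b.1 ord0 i + l b i / m) (nbhs x)) => i.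
  have : nbhs (x ord0 i) `]b.1 ord0 i, (b.1 ord0 i + l b i / m)[%classic.
    by apply: open_nbhs_nbhs; split; [exact: itv_open | rewrite /= in_itv; exact: Ox].
  move=> /(@coord_continuous R 1 d ord0 i x).
  by apply: (@filterS _ (nbhs x)) => y /=; rewrite in_itv.
have cptC : compact (cube r).
  have := @rV_compact R d (fun=> `[0, r]%classic) (fun=> @segment_compact R 0 r).
  congr (compact _); apply/seteqP; split=> x /= xC i; have := xC i;
  by rewrite in_itv.
have CO : cube r `<=` cover B O.
  move=> x /CB[b Bb bx]; exists b => // i.
  have /andP[b1 b2] := bx i; rewrite b1/= /l.
  have : b.2 ord0 i - b.1 ord0 i < (b.2 ord0 i - b.1 ord0 i) / m.
    by rewrite ltr_pdivlMr// gtr_pMr// subr_gt0 (lt_le_trans b1).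
  by move: b2; lra.
have [D DB CD] : finite_subset_cover B O (cube r).
  by move: cptC; rewrite compact_cover; apply.
pose l' (bi : D * 'I_d) := if 0 < l (val bi.1) bi.2 then l (val bi.1) bi.2 else 1.
have [|s s0 sl] := @fin_pos_lb R _ l'; first by move=> bi; rewrite /l'; case: ifP.
have q0 : 0 < m ^- 2 - m ^-1.
  by rewrite subr_gt0 -exprVn expr2 ltr_pMr ?invr_gt0// invf_gt1.
(* With this [N] the rounding error 1 is below the gain from [1 / m] to [1 / m ^ 2]. *)
pose N := (Num.trunc (r / (s * (m ^- 2 - m^-1)))).+1.
have N0 : 0 < N%:R :> R by [].
pose P b i : pred 'I_N := fun k => b.1 ord0 i < r * k%:R / N%:R < b.1 ord0 i + l b i / m.
have cardP b i : b \in D -> (#|P b i|%:R <= N%:R / (m ^+ 2 * r) * Num.max 0 (l b i)).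
  move=> bD; have [lb|lb] := leP (l b i) 0.
    rewrite eq_card0 ?mulr0// => k; rewrite !inE /P; apply/negP => /andP[h1 h2].
    have : l b i / m <= 0 by rewrite pmulr_lle0 ?invr_gt0.
    by have := lt_trans h1 h2; lra.
  have sl' : s <= l b i by have := sl ([` bD]%fset, i); rewrite /l' /= lb.
  rewrite (eq_card (B := [pred k : 'I_N | N%:R / r * b.1 ord0 i < k%:R <
      N%:R / r * b.1 ord0 i + N%:R / r * (l b i / m)])); last first.
    move=> k; rewrite !inE /P -mulrDr; congr (_ && _).
      by rewrite ltr_pdivlMr// -ltr_pdivrMl//; congr (_ < _); ring.
    by rewrite ltr_pdivrMr// -ltr_pdivlMl//; congr (_ < _); ring.
  apply: le_trans (count_grid_le _ _ _) _.
    by rewrite !mulr_ge0 ?invr_ge0// ltW.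
  have : r / (s * (m ^- 2 - m^-1)) < N%:R by exact: truncnS_gt.
  rewrite ltr_pdivrMr ?mulr_gt0// => h.
  have {}h : r < N%:R * (l b i * (m ^- 2 - m^-1)).
    by apply: lt_le_trans h _; rewrite ler_pM2l// ler_pM2r.
  have -> : N%:R / (m ^+ 2 * r) * l b i =
      N%:R / r * (l b i / m) + (N%:R * (l b i * (m ^- 2 - m^-1))) / r.
    by field; rewrite !gt_eqF.
  by rewrite lerD2l ler_pdivlMr// mul1r ltW.
have cardQ b : b \in D -> #|[pred f : {ffun 'I_d -> 'I_N} | [forall i, P b i (f i)]]|%:R
    <= (N%:R / (m ^+ 2 * r)) ^+ d * box_volume b.
  move=> bD; rewrite card_ffun_family natr_prod.
  rewrite -[X in _ ^+ X]card_ord -prodr_const -big_split /=.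
  by apply: ler_prod => i _; rewrite ler0n/=; exact: cardP.
have total : N%:R ^+ d <= \sum_(b <- D) (N%:R / (m ^+ 2 * r)) ^+ d * box_volume b.
  apply: (@le_trans _ _ (\sum_(b <- D)
     #|[pred f : {ffun 'I_d -> 'I_N} | [forall i, P b i (f i)]]|%:R)); last first.
    by rewrite big_seq [leRHS]big_seq; apply: ler_sum => b; exact: cardQ.
  have -> : N%:R ^+ d = \sum_(f : {ffun 'I_d -> 'I_N}) 1 :> R.
    by rewrite sumr_const card_ffun !card_ord natrX.
  rewrite (eq_bigr (fun b => \sum_(f : {ffun 'I_d -> 'I_N}) ([forall i, P b i (f i)])%:R)); last first.
    move=> b _; rewrite -sum1_card natr_sum big_mkcond /=.
    by apply: eq_bigr => f _; rewrite inE; case: ifP.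
  rewrite exchange_big /=; apply: ler_sum => f _.
  have [|b bD bf] := CD (\row_i (r * (f i)%:R / N%:R)).
    move=> i; rewrite mxE !mulr_ge0 ?invr_ge0 ?(ltW r0)//=.
    by rewrite ler_pdivrMr// ler_pM2l// ler_nat ltnW.
  rewrite (big_rem b)//= (_ : [forall i, _]) ?lerDl ?sumr_ge0//.
  by apply/forallP => i; have := bf i; rewrite mxE.
apply: esum_ge; exists [set` D].
  by split; [exact: finite_fset | move=> b /DB/set_mem].
rewrite -fsbig_seq ?fset_uniq// sumEFin lee_fin.
move: total; rewrite -mulr_sumr expr_div_n mulrAC ler_pdivlMr; last first.
  by rewrite exprn_gt0// mulr_gt0// exprn_gt0.
rewrite ler_pM2l ?exprn_gt0//.
by rewrite exprMn -exprM mul2n -addnn mulrC.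
Qed.

End CubeMeasure.

(** * The torus and its fundamental domain *)

Section Torus.
Variables (R : realType) (d : nat).
Implicit Types (S : set 'rV[R]_d) (v x : 'rV[R]_d) (m : 'rV[int]_d).

Local Notation mu := (@lebesgue_outer R d).
Local Notation M := (@lebesgue_measurable R d).
Local Notation cube := (@cube R d).
Local Notation Q := (@torus_dom R d).
Local Notation iv := (@int_vec R d).

Lemma int_vecD m1 m2 : iv (m1 + m2) = iv m1 + iv m2.
Proof. by apply/rowP => i; rewrite !mxE intrD. Qed.

Lemma int_vecN m : iv (- m) = - iv m.
Proof. by apply/rowP => i; rewrite !mxE intrN. Qed.

Lemma int_vec0 : iv 0 = 0.
Proof. by apply/rowP => i; rewrite !mxE. Qed.

(** The integer translation that brings a point to the fundamental domain. *)
Definition to_torus x : 'rV[int]_d := \row_i - Num.floor (x ord0 i).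

Lemma to_torusP x : Q (x + iv (to_torus x)).
Proof.
move=> i; rewrite !mxE intrN.
by have := floor_itv (x ord0 i); rewrite intrD; lra.
Qed.

Lemma to_torus_uniq x m : Q (x + iv m) -> m = to_torus x.
Proof.
move=> Qxm; apply/rowP => i; rewrite !mxE.
have := Qxm i; rewrite !mxE => h; apply: oppr_inj; rewrite opprK.
by apply/esym/floor_def; rewrite intrD intrN; lra.
Qed.

Lemma measurable_torus_dom : M Q.
Proof.
have -> : Q = \bigcap_(i in [set: 'I_d])
   ([set x : 'rV[R]_d | 0 <= x ord0 i] `&` [set x : 'rV[R]_d | x ord0 i < 1]).
  apply/seteqP; split=> [x Qx i _ /=|x Qx i].
    by have /andP[] := Qx i.
  by have [/= -> ->] := Qx i I.
apply: fin_bigcap_measurable => [|i _]; first exact: finite_finset.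
apply: measurableI; first exact: measurable_coord_ge.
exact: measurable_coord_lt.
Qed.

Lemma measurable_cube (r : R) : M (cube r).
Proof.
have -> : cube r = \bigcap_(i in [set: 'I_d])
   ([set x : 'rV[R]_d | 0 <= x ord0 i] `&` [set x : 'rV[R]_d | x ord0 i <= r]).
  apply/seteqP; split=> [x Qx i _ /=|x Qx i].
    by have /andP[] := Qx i.
  by have [/= -> ->] := Qx i I.
apply: fin_bigcap_measurable => [|i _]; first exact: finite_finset.
apply: measurableI; first exact: measurable_coord_ge.
exact: measurable_coord_le.
Qed.

Lemma outer_cube_le (r : R) : 0 < r ->
  (mu (cube r) <= ((2 * r) ^+ d)%:E)%E.
Proof.
move=> r0; apply: (@le_trans _ _ (mu (box (const_mx (- r), const_mx r)))).
  apply: le_lebesgue_outer => x xr i; rewrite !mxE.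
  by have := xr i; lra.
apply: le_trans (outer_box_le _) _; rewrite lee_fin /box_volume.
rewrite (eq_bigr (fun=> 2 * r)) => [|i _]; last first.
  by rewrite !mxE opprK max_r; lra.
by rewrite prodr_const card_ord.
Qed.

Lemma exists_expr_near1 (e : R) : 0 < e -> exists2 h : R, 0 < h <= 2^-1 & 1 - e <= (1 - h) ^+ d.
Proof.
move=> e0; pose h := Num.min 2^-1 (e / (d%:R + 1)).
have h0 : 0 < h by rewrite lt_min invr_gt0// divr_gt0// ltr_wpDl.
have h2 : h <= 2^-1 by rewrite ge_min lexx.
have dh : d%:R * h <= e.
  apply: (@le_trans _ _ (d%:R * (e / (d%:R + 1)))).
    by rewrite ler_wpM2l// ge_min lexx orbT.
  by rewrite mulrCA ger_pMr// ler_pdivrMr ?mul1r ?lerDl// ltr_wpDl.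
exists h; first by rewrite h0.
apply: (@le_trans _ _ (1 - d%:R * h)); first by rewrite lerD2l lerN2.
by apply: bernoulli_sub; lra.
Qed.

Lemma outer_torus_dom : mu Q = 1%E.
Proof.
apply/eqP; rewrite eq_le; apply/andP; split; apply/lee_addgt0Pr => e e0.
  have [|h /andP[h0 h2] hd] := @exists_expr_near1 (e / (1 + e)).
    by rewrite divr_gt0// addr_gt0.
  have h1 : 0 < 1 - h by lra.
  apply: (@le_trans _ _ (box_volume (const_mx (1 - (1 - h)^-1), const_mx 1 : 'rV[R]_d))%:E).
    apply: le_trans (outer_box_le _); apply: le_lebesgue_outer => x Qx i.
    rewrite !mxE; have := Qx i; have : 1 < (1 - h)^-1 by rewrite invf_gt1//; lra.
    lra.
  rewrite -EFinD lee_fin /box_volume (eq_bigr (fun=> (1 - h)^-1)); last first.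
    move=> i _; rewrite !mxE opprB addrC subrK max_r// invr_ge0; exact: ltW.
  rewrite prodr_const card_ord exprVn -[leLHS]mul1r ler_pdivrMr ?exprn_gt0//.
  have e1 : 0 < 1 + e by rewrite addr_gt0.
  have E : (1 + e) * (1 - e / (1 + e)) = 1 by field; rewrite gt_eqF.
  by rewrite -[leLHS]E ler_pM2l.
have [h /andP[h0 h2] hd] := exists_expr_near1 e0.
have h1 : 0 < 1 - h by lra.
apply: (@le_trans _ _ (((1 - h) ^+ d)%:E + e%:E)%E).
  by rewrite -EFinD lee_fin; lra.
rewrite leeD2r//; apply: le_trans (outer_cube_ge _ h1) _.
by apply: le_lebesgue_outer => x xh i; have := xh i; lra.
Qed.

Lemma bounded_setP S : bounded_set S <->
  exists r : R, forall x, S x -> forall i, `|x ord0 i| <= r.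
Proof.
split=> [[r [rreal Sr]]|[r Sr]].
  exists (r + 1) => x Sx i; apply: le_trans (Sr _ _ _ Sx); last by rewrite ltrDl.
  rewrite [leRHS]/Num.norm /= mx_normrE; apply/bigmax_geP; right.
  by exists (ord0, i).
exists (Num.max 0 r); split; first exact: num_real.
move=> N; rewrite gt_max => /andP[N0 rN] x Sx.
rewrite /= [leLHS]/Num.norm /= mx_normrE; apply/bigmax_leP; split; first exact: ltW.
by move=> [i j] _; rewrite /= ord1; apply: le_trans (Sr _ Sx _) (ltW rN).
Qed.

Lemma bounded_subset (E S : set 'rV[R]_d) : E `<=` S -> bounded_set S -> bounded_set E.
Proof.
move=> ES /bounded_setP[r Sr]; apply/bounded_setP.
by exists r => x /ES /Sr.
Qed.

Lemma bounded_outer_fin S : bounded_set S -> (mu S < +oo)%E.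
Proof.
move=> /bounded_setP[r Sr].
apply: (@le_lt_trans _ _ (box_volume (const_mx (- r - 1), const_mx r : 'rV[R]_d))%:E);
  last by rewrite ltry.
apply: le_trans (outer_box_le _); apply: le_lebesgue_outer => x Sx i.
by rewrite !mxE; have := Sr _ Sx i; rewrite ler_norml; lra.
Qed.

Lemma bounded_shift v S : bounded_set S -> bounded_set [set x | S (x + v)].
Proof.
move=> /bounded_setP[r Sr]; apply/bounded_setP.
exists (r + \sum_i `|v ord0 i|) => x /= Sx i.
have -> : x ord0 i = (x + v) ord0 i - v ord0 i by rewrite !mxE addrK.
apply: le_trans (ler_normB _ _) _; apply: lerD; first exact: Sr.
by rewrite (bigD1 i)//= lerDl sumr_ge0.
Qed.

Lemma finite_int_vec (r : R) : finite_set [set m : 'rV[int]_d | forall i, `|(m ord0 i)%:~R : R| <= r].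
Proof.
pose N := Num.trunc r.
pose g (f : {ffun 'I_d -> 'I_(N + N).+1}) : 'rV[int]_d := \row_i ((f i : int) - N%:Z).
apply: (@sub_finite_set _ _ (g @` setT)); last exact: finite_image.
move=> m mr; exists [ffun i => inord (absz (m ord0 i + N%:Z))] => //.
apply/rowP => i; rewrite mxE ffunE.
have : (absz (m ord0 i) <= N)%N.
  have := mr i; rewrite /= -intr_norm -natr_absz => h.
  by rewrite truncn_ge_nat// (le_trans _ h).
move: (m ord0 i) => z zN; rewrite inordK; lia.
Qed.

(** One finite set of translations computes [chi S] on the whole fundamental
    domain, so that [chi S] can be integrated term by term. *)
Lemma chi_support S : bounded_set S -> exists F : {fset 'rV[int]_d},
  forall x, Q x -> forall m, S (x + iv m) -> m \in F.
Proof.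
move=> /bounded_setP[r Sr]; have /finite_fsetP[F FE] := finite_int_vec (r + 1).
exists F => x Qx m Sxm; suff : [set` F] m by [].
rewrite -FE => i /=; have := Sr _ Sxm i; rewrite !mxE.
by have := Qx i; rewrite !ler_norml; lra.
Qed.

Lemma chi_support_at S x : bounded_set S -> exists F : {fset 'rV[int]_d},
  forall m, S (x + iv m) -> m \in F.
Proof.
move=> bS; have [F SF] := chi_support (bounded_shift x bS).
exists F => m Sxm; apply: (SF 0) => [i|/=]; first by rewrite mxE lexx ltr01.
by rewrite add0r addrC.
Qed.

Lemma chi_shift_int S m x : chi S (x + iv m) = chi S x.
Proof.
rewrite /chi [RHS](reindex_fsbigT (fun k => m + k)).
  by apply: eq_fsbigr => k _; rewrite int_vecD addrA.
by exists (fun k => - m + k) => k; rewrite addrA ?addNr ?subrr add0r.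
Qed.

Lemma chi_shift S v x : chi [set y | S (y + v)] x = chi S (x + v).
Proof. by apply: eq_fsbigr => k _; rewrite [in RHS]addrAC. Qed.

Lemma chiE S (F : {fset 'rV[int]_d}) x :
  (forall m, S (x + iv m) -> m \in F) -> chi S x = \sum_(m <- F) \1_S (x + iv m).
Proof.
move=> SF; rewrite /chi (fsbigTE F)// => m mF.
by rewrite indicE memNset// => /SF; rewrite (negbTE mF).
Qed.

(** The translates of [S] cut by the fundamental domain reassemble to [S]. *)
Lemma outer_unfold S (F : {fset 'rV[int]_d}) : M S ->
  (forall x, Q x -> forall m, S (x + iv m) -> m \in F) ->
  mu S = (\sum_(m <- F) mu ([set x | S (x + iv m)%R] `&` Q))%E.
Proof.
move=> mS SF.
have SE : S = \bigcup_(m in [set` F]) (S `&` [set x | Q (x - iv m)]).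
  apply/seteqP; split=> [x Sx|x [m _ []//]].
  exists (- to_torus x); last by split => //=; rewrite int_vecN opprK; exact: to_torusP.
  apply: (SF (x + iv (to_torus x))); first exact: to_torusP.
  by rewrite int_vecN addrK.
rewrite [in LHS]SE outer_bigcup_trivIset; last 3 first.
- exact: countableP.
- move=> m _; apply: measurableI => //; have := measurable_shift (- iv m) measurable_torus_dom.
  exact.
- move=> m n _ _ [x [[_ /= Qm] [_ /= Qn]]]; apply: oppr_inj.
  have -> : - m = to_torus x by apply: to_torus_uniq; rewrite int_vecN.
  by apply/esym/to_torus_uniq; rewrite int_vecN.
rewrite esum_fset; last 2 first.
- exact: finite_fset.
- by move=> m _; exact: lebesgue_outer_ge0.
rewrite -fsbig_seq ?fset_uniq//; apply: eq_bigr => m _.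
rewrite -(outer_shift (iv m)); congr mu.
by apply/seteqP; split=> x [] /=; rewrite addrK.
Qed.

End Torus.

(** * Birkhoff sums and their mean *)

Section Averaging.
Variables (R : realType) (d : nat).
Implicit Types (S : set 'rV[R]_d) (v x alpha : 'rV[R]_d) (m : 'rV[int]_d).

Local Notation mu := (@lebesgue_outer R d).
Local Notation M := (@lebesgue_measurable R d).
Local Notation Q := (@torus_dom R d).
Local Notation iv := (@int_vec R d).
Local Notation L := (caratheodory_type mu).
Local Notation lam := (@lebesgue_rV R d).

Lemma mes_ge0 S : 0 <= mes S.
Proof. by rewrite /mes fine_ge0// lebesgue_outer_ge0. Qed.

Lemma mesE S : bounded_set S -> (mes S)%:E = mu S.
Proof.
by move=> /bounded_outer_fin Sfin; rewrite fineK// ge0_fin_numE ?lebesgue_outer_ge0.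
Qed.

Lemma chi_ge0 S x : 0 <= chi S x.
Proof. by apply: fsumr_ge0 => m _; rewrite indicE. Qed.

Lemma measurable_indic_shift S v : M S ->
  measurable_fun (Q : set L) (fun x : L => (\1_S ((x : 'rV[R]_d) + v) : R)%:E).
Proof.
move=> mS; apply/measurable_EFinP.
have mA : measurable ([set x : 'rV[R]_d | S (x + v)] : set L) by exact: measurable_shift.
exact: (measurable_indic (D := (Q : set L)) mA).
Qed.

Lemma measurable_chi S : bounded_set S -> M S ->
  measurable_fun (Q : set L) (fun x : L => (chi S x)%:E).
Proof.
move=> bS mS; have [F SF] := chi_support bS.
apply: (@eq_measurable_fun _ _ L _ Q
    (fun x : L => \sum_(m <- F) (\1_S ((x : 'rV[R]_d) + iv m) : R)%:E)).
  by move=> x /set_mem Qx; rewrite sumEFin (chiE (SF _ Qx)).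
by apply: emeasurable_sum => m; exact: measurable_indic_shift.
Qed.

(** The pieces of [S] in the integer translates of the fundamental domain are
    counted once each by [chi S]. *)
Lemma integral_chi S : bounded_set S -> M S ->
  (\int[lam]_(x in Q) (chi S x)%:E)%E = mu S.
Proof.
move=> bS mS; have [F SF] := chi_support bS.
rewrite (eq_integral (fun x : L => \sum_(m <- F) (\1_S ((x : 'rV[R]_d) + iv m) : R)%:E)%E); last first.
  by move=> x /set_mem Qx; rewrite sumEFin (chiE (SF _ Qx)).
rewrite ge0_integral_sum; last 3 first.
- exact: measurable_torus_dom.
- by move=> m; exact: measurable_indic_shift.
- by move=> m x _; rewrite lee_fin indicE.
rewrite (outer_unfold mS SF); apply: eq_bigr => m _.
have mA : measurable ([set x : 'rV[R]_d | S (x + iv m)] : set L) by exact: measurable_shift.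
have mQ : measurable (Q : set L) by exact: measurable_torus_dom.
by move: (integral_indic lam mQ mA) => ->.
Qed.

Definition birkhoff alpha S n x : R := \sum_(0 <= k < n) chi S (x + alpha *+ k).

Lemma measurable_birkhoff alpha S n : bounded_set S -> M S ->
  measurable_fun (Q : set L) (fun x : L => (birkhoff alpha S n x)%:E).
Proof.
move=> bS mS; under eq_fun do rewrite -sumEFin.
apply: emeasurable_sum => k; under eq_fun do rewrite -chi_shift.
apply: measurable_chi; [exact: bounded_shift | exact: measurable_shift].
Qed.

Lemma integral_birkhoff alpha S n : bounded_set S -> M S ->
  (\int[lam]_(x in Q) (birkhoff alpha S n x)%:E = (n%:R * mes S)%:E)%E.
Proof.
move=> bS mS; under eq_integral do rewrite -sumEFin.
have bk k : bounded_set [set x | S (x + alpha *+ k)] by exact: bounded_shift.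
have mk k : M [set x | S (x + alpha *+ k)] by exact: measurable_shift.
rewrite ge0_integral_sum; last 3 first.
- exact: measurable_torus_dom.
- by move=> k; under eq_fun do rewrite -chi_shift; exact: measurable_chi.
- by move=> k x _; rewrite lee_fin chi_ge0.
under eq_bigr do under eq_integral do rewrite -chi_shift.
rewrite (eq_bigr (fun=> (mes S)%:E)) => [|k _].
  by rewrite sumEFin big_const_nat subn0 iter_addr_0 mulr_natl.
by rewrite integral_chi// outer_shift mesE.
Qed.

Lemma birkhoff_ge0 alpha S n x : 0 <= birkhoff alpha S n x.
Proof. by apply: sumr_ge0 => k _; exact: chi_ge0. Qed.

Lemma mean_birkhoff alpha S n (kappa C : R) : bounded_set S -> M S -> 0 <= kappa ->
  {ae lam, forall x, Q x -> `|birkhoff alpha S n x - n%:R * kappa| <= C} ->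
  `|n%:R * mes S - n%:R * kappa| <= `|C|.
Proof.
move=> bS mS k0 H.
have nk0 : 0 <= n%:R * kappa by rewrite mulr_ge0.
have intcst (c : R) : (\int[lam]_(x in Q) (cst c%:E) x = c%:E)%E.
  have mQ : measurable (Q : set L) by exact: measurable_torus_dom.
  by rewrite (integral_cst lam mQ) [X in (_ * X)%E]outer_torus_dom mule1.
have up : n%:R * mes S <= n%:R * kappa + `|C|.
  rewrite -lee_fin -(integral_birkhoff alpha n bS mS) -intcst.
  apply: ae_ge0_le_integral => //; first exact: measurable_torus_dom.
  - by move=> x _; rewrite lee_fin birkhoff_ge0.
  - exact: measurable_birkhoff.
  - by move=> x _; rewrite lee_fin addr_ge0.
  apply: negligibleS H; apply: subsetC => x /= Hx Qx; rewrite lee_fin.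
  by have := Hx Qx; have := ler_norm C; rewrite ler_norml; lra.
have dn : Num.max 0 (n%:R * kappa - `|C|) <= n%:R * mes S.
  rewrite -lee_fin -(integral_birkhoff alpha n bS mS) -intcst.
  apply: ae_ge0_le_integral => //; first exact: measurable_torus_dom.
  - by move=> x _; rewrite lee_fin le_max lexx.
  - by move=> x _; rewrite lee_fin birkhoff_ge0.
  - exact: measurable_birkhoff.
  apply: negligibleS H; apply: subsetC => x /= Hx Qx; rewrite lee_fin ge_max birkhoff_ge0/=.
  by have := Hx Qx; have := ler_norm C; rewrite ler_norml; lra.
by move: dn; rewrite ge_max ler_norml => /andP[_ dn]; lra.
Qed.

(** A bound on the Birkhoff sums already forces the constant to be the measure,
    since the mean of [chi S] over the torus is the measure of [S]. *)
Lemma bounded_remainder_mean alpha S (kappa C : R) :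
  bounded_set S -> M S -> 0 <= kappa ->
  (forall n, (1 <= n)%N ->
    {ae lam, forall x, Q x -> `|birkhoff alpha S n x - n%:R * kappa| <= C}) ->
  bounded_remainder alpha S.
Proof.
move=> bS mS k0 H; suff mk : mes S = kappa.
  by split => //; exists C => n n1; rewrite mk; exact: H.
apply/eqP; rewrite -subr_eq0 -normr_eq0; apply: contraT => nz.
have pos : 0 < `|mes S - kappa| by rewrite lt_neqAle eq_sym nz normr_ge0.
pose n := (Num.trunc (`|C| / `|mes S - kappa|)).+1.
have := mean_birkhoff bS mS k0 (H n isT).
rewrite -mulrBr normrM ger0_norm// leNgt -ltr_pdivrMr//.
by rewrite truncnS_gt.
Qed.

End Averaging.

(** * Counting orbit points *)

Section OrbitCount.
Variables (R : realType) (d : nat).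
Implicit Types (S : set 'rV[R]_d) (v x y alpha beta : 'rV[R]_d) (m : 'rV[int]_d).

Local Notation mu := (@lebesgue_outer R d).
Local Notation M := (@lebesgue_measurable R d).
Local Notation Q := (@torus_dom R d).
Local Notation iv := (@int_vec R d).
Local Notation lam := (@lebesgue_rV R d).

Lemma negligible_outer S : lam.-negligible S <-> mu S = 0%E.
Proof.
split=> [[A [mA A0 SA]]|S0]; last first.
  by exists S; split => //; exact: measurable_null.
apply/eqP; rewrite eq_le lebesgue_outer_ge0 andbT.
by apply: le_trans (le_lebesgue_outer SA) _; rewrite -[mu A]/(lam A) A0.
Qed.

(** Cardinality as an extended sum: reindexing and inclusion then hold without
    finiteness conditions. *)
Definition cnt (A : set (int * 'rV[int]_d)) : \bar R := (\esum_(v in A) 1)%E.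

Lemma le_cnt A B : A `<=` B -> (cnt A <= cnt B)%E.
Proof.
move=> AB; rewrite /cnt esum_mkcond [leRHS]esum_mkcond.
apply: le_esum => v _; case: ifP => [/set_mem/AB/mem_set -> //|_].
by case: ifP.
Qed.

Lemma chi_esum S x : bounded_set S ->
  (chi S x)%:E = (\esum_(m in [set m | S (x + iv m)%R]) 1)%E.
Proof.
move=> bS; have [F SF] := chi_support_at x bS.
have finA : finite_set [set m | S (x + iv m)].
  by apply: (@sub_finite_set _ _ [set` F]) => //; exact: finite_fset.
rewrite esum_fset// fsbig_mkcond (fsbigTE F); last first.
  move=> m mF; rewrite patchE memNset// => /SF.
  by rewrite (negbTE mF).
rewrite (chiE SF) -sumEFin; apply: eq_bigr => m _.
by rewrite patchE indicE; case: ifP => h; rewrite [_ \in S]h.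
Qed.

(** The orbit of [x] is parametrized by [Z x Z^d], in which a linear map between
    the groups acts by a bijection. *)
Definition orbit_hits alpha S x : set (int * 'rV[int]_d) :=
  [set v | S (x + alpha *~ v.1 + iv v.2)].

Lemma cnt_birkhoff alpha S x (a : int) n : bounded_set S ->
  cnt (orbit_hits alpha S x `&` [set v | a <= v.1 < a + n%:Z]) =
  (birkhoff alpha S n (x + alpha *~ a))%:E.
Proof.
move=> bS; pose J (k : nat) := orbit_hits alpha S x `&` [set v | v.1 = a + k%:Z].
have -> : orbit_hits alpha S x `&` [set v | a <= v.1 < a + n%:Z] =
    \bigcup_(k in `I_n) J k.
  apply/seteqP; split=> [v [Ov /= /andP[av vn]]|v [k /= kn [Ov /= ->]]].
    by exists (absz (v.1 - a)) => /=; [lia | split => //=; lia].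
  by split => //=; lia.
rewrite /cnt esum_bigcupT//; last first.
  by move=> j k _ _ [v [[_ /= vj] [_ /=]]]; rewrite vj => /addrI/eqP; rewrite eqz_nat => /eqP.
rewrite esum_fset//; last by move=> k _; exact: esum_ge0.
rewrite -fsbig_ord /birkhoff big_mkord -sumEFin; apply: eq_bigr => k _.
rewrite chi_esum//.
rewrite (reindex_esum [set m | S (x + alpha *~ a + alpha *+ k + iv m)] _
  (fun m => (a + k%:Z, m)))//.
split=> [m /= Sm|m1 m2 _ _ [//]|[b m] [Ob /= bE]].
- by split => //=; rewrite /orbit_hits /= mulrzDr addrA -pmulrn.
- exists m; last by rewrite bE.
  by move: Ob; rewrite /orbit_hits /= bE mulrzDr addrA -pmulrn.
Qed.

(** The Birkhoff bound started at every integer time, negative ones included: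
    a window of orbit points may begin anywhere. *)
Definition good_point alpha S (C : R) x := forall (a : int) n, (1 <= n)%N ->
  `|birkhoff alpha S n (x + alpha *~ a) - n%:R * mes S| <= C.

Lemma birkhoff_shift_int alpha S n x m :
  birkhoff alpha S n (x + iv m) = birkhoff alpha S n x.
Proof. by apply: eq_bigr => k _; rewrite addrAC chi_shift_int. Qed.

(** Almost every point of the whole space is good: the exceptional set is a
    countable union of translates of null sets of the torus. *)
Lemma bounded_remainder_good alpha S : bounded_remainder alpha S ->
  exists2 C : R, 0 <= C & mu (~` [set x | good_point alpha S C x]) = 0%E.
Proof.
move=> [bS mS [C HC]]; exists `|C| => //.
pose bad n := [set y | Q y /\ (1 <= n)%N /\ ~ (`|birkhoff alpha S n y - n%:R * mes S| <= `|C|)].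
have bad0 n : mu (bad n) = 0%E.
  apply/negligible_outer; have [n0|n1] := leqP n 0.
    have -> : bad n = set0.
      by apply/seteqP; split => // y [_ []]; rewrite leqNgt ltnS n0.
    exact: negligible_set0.
  apply: negligibleS (HC n n1) => y [Qy [_ nC]] /= H; apply: nC.
  by apply: le_trans (H Qy) _; exact: ler_norm.
apply/eqP; rewrite eq_le lebesgue_outer_ge0 andbT.
apply: (@le_trans _ _ (mu (\bigcup_(p in [set: int * nat * 'rV[int]_d])
    [set x | bad p.1.2 (x + (alpha *~ p.1.1 + iv p.2))%R]))).
  apply: le_lebesgue_outer => x /= /existsNP[a /existsNP[n /not_implyP[n1 nC]]].
  exists (a, n, to_torus (x + alpha *~ a)) => //=; rewrite addrA; split.
    exact: to_torusP.
  by rewrite birkhoff_shift_int.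
apply: le_trans (outer_bigcup _ (countableP _)) _.
by rewrite esum1// => p _; rewrite outer_shift.
Qed.

Lemma orbit_hits_ceil alpha S x (u w : R) :
  orbit_hits alpha S x `&` [set v | u <= v.1%:~R < w]%R =
  orbit_hits alpha S x `&` [set v | Num.ceil u <= v.1 < Num.ceil w].
Proof. by apply/seteqP; split=> v [Ov] /=; rewrite ceil_le_int ceil_gt_int. Qed.

(** Windows with real ends, as they arise from [0 <= c n + t < N]; rounding the ends
    changes the length by at most 1. *)
Lemma good_point_cnt alpha S C x (u w : R) : bounded_set S -> 0 <= C ->
  good_point alpha S C x ->
  (((w - u - 1) * mes S - C)%:E <=
   cnt (orbit_hits alpha S x `&` [set v | u <= v.1%:~R < w]%R))%E /\
  (u <= w ->
   (cnt (orbit_hits alpha S x `&` [set v | u <= v.1%:~R < w]%R) <=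
   ((w - u + 1) * mes S + C)%:E)%E).
Proof.
move=> bS C0 gx; rewrite orbit_hits_ceil.
set a := Num.ceil u; set b := Num.ceil w.
have m0 := mes_ge0 S.
have [ua ub] : u <= a%:~R /\ a%:~R < u + 1.
  by have := ceil_itv u; rewrite -/a intrB; lra.
have [wa wb] : w <= b%:~R /\ b%:~R < w + 1.
  by have := ceil_itv w; rewrite -/b intrB; lra.
have [ba|ab] := leP b a.
  have -> : orbit_hits alpha S x `&` [set v | a <= v.1 < b] = set0.
    by apply/seteqP; split => // v [_ /= /andP[h1 h2]]; lia.
  have baR : b%:~R <= a%:~R :> R by rewrite ler_int.
  rewrite /cnt esum_set0 !lee_fin; split=> [|uw].
    have : (w - u - 1) * mes S <= 0 by rewrite mulr_le0_ge0//; lra.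
    lra.
  by rewrite addr_ge0// mulr_ge0//; lra.
have [n n1 bE] : exists2 n : nat, (1 <= n)%N & b = a + n%:Z.
  by exists (absz (b - a)); lia.
rewrite bE cnt_birkhoff// !lee_fin.
have := gx a n n1; rewrite ler_norml => /andP[h1 h2].
have nE : n%:R = b%:~R - a%:~R :> R by rewrite bE intrD addrC addKr.
have le1 : (w - u - 1) * mes S <= n%:R * mes S by rewrite ler_wpM2r// nE; lra.
have le2 : n%:R * mes S <= (w - u + 1) * mes S by rewrite ler_wpM2r// nE; lra.
by split=> [|_]; lra.
Qed.

End OrbitCount.

(** * Linear maps between the groups *)

Section Forward.
Variables (R : realType) (d : nat).
Implicit Types (S : set 'rV[R]_d) (x y alpha beta : 'rV[R]_d) (m : 'rV[int]_d).
Implicit Types (A B : 'M[R]_d).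

Local Notation mu := (@lebesgue_outer R d).
Local Notation M := (@lebesgue_measurable R d).
Local Notation Q := (@torus_dom R d).
Local Notation iv := (@int_vec R d).
Local Notation lam := (@lebesgue_rV R d).
Local Notation cnt := (@cnt R d).

Lemma coordMz x (n : int) i : (x *~ n) ord0 i = n%:~R * x ord0 i.
Proof. by rewrite -scaler_int mxE. Qed.

Lemma Zspan_uniq alpha (n n' : int) m m' : (1 <= d)%N -> irrational_vec alpha ->
  alpha *~ n + iv m = alpha *~ n' + iv m' -> n = n' /\ m = m'.
Proof.
move=> d1 ialpha E.
have key i : m ord0 i = m' ord0 i /\ n = n'.
  have := ialpha (m ord0 i - m' ord0 i)%:~R (fun j => if j == i then (n - n')%:~R else 0).
  rewrite (bigD1 i)//= eqxx big1 ?addr0; last first.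
    by move=> j /negbTE ->; rewrite rmorph0 mul0r.
  case=> [|/eqP + /(_ i)]; last first.
    rewrite eqxx intr_eq0 subr_eq0 => /eqP mi /eqP.
    by rewrite intr_eq0 subr_eq0 => /eqP.
  rewrite !ratr_int; move/rowP/(_ i): E; rewrite !mxE !coordMz !intrB.
  lra.
by split; [have [] := key (Ordinal d1) | apply/rowP => i; have [] := key i].
Qed.

Lemma ZspanE alpha n m : Zspan alpha (alpha *~ n + iv m).
Proof. by exists n, m. Qed.

(** The coefficients of the integral linear form are read off from the images of
    [alpha] and of the unit vectors, which generate the group. *)
Lemma Zspan_linear_coord alpha beta A :
  (forall x, Zspan alpha x -> Zspan beta (x *m A)) ->
  exists (a : int) (b : 'I_d -> int) (h : int -> 'rV[int]_d -> 'rV[int]_d),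
  forall n m, (alpha *~ n + iv m) *m A =
    beta *~ (a * n + \sum_i b i * m ord0 i) + iv (h n m).
Proof.
move=> H.
have [a [k aE]] : Zspan beta (alpha *m A).
  by apply: H; exists 1, 0; rewrite mulr1z int_vec0 addr0.
have rowH i : exists p : int * 'rV[int]_d, row i A = beta *~ p.1 + iv p.2.
  have [n [m nm]] : Zspan beta (row i A).
    rewrite rowE; apply: H; exists 0, (delta_mx 0 i); rewrite mulr0z add0r.
    by apply/rowP => j; rewrite !mxE; case: (_ && _).
  by exists (n, m).
have [f fE] := choice rowH.
exists a, (fun i => (f i).1), (fun n m => k *~ n + \sum_i (f i).2 *~ m ord0 i).
move=> n m; rewrite mulmxDl -scaler_int -scalemxAl scaler_int aE mulrzDl.
rewrite mulmx_sum_row (eq_bigr (fun i =>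
  beta *~ ((f i).1 * m ord0 i) + iv ((f i).2 *~ m ord0 i))); last first.
  move=> i _; rewrite mxE scaler_int fE mulrzDl -mulrzA.
  by rewrite /int_vec raddfMz.
rewrite big_split /= mulrzDr -mulrz_sumr -!addrA; congr (_ + _).
  by rewrite -mulrzA.
by rewrite addrCA /int_vec raddfD raddfMz /=; congr (_ + (_ + _)); rewrite raddf_sum.
Qed.

(** The slope of the linear form on the line of the orbit vanishes only for the
    zero form, by irrationality. *)
Lemma Zspan_slope_eq0 alpha (a : int) (b : 'I_d -> int) : irrational_vec alpha ->
  a%:~R - \sum_i (b i)%:~R * alpha ord0 i = 0 -> a = 0 /\ forall i, b i = 0.
Proof.
move=> ialpha E; have := ialpha a%:~R (fun i => (- b i)%:~R).
case=> [|/eqP]; last first.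
  rewrite intr_eq0 => /eqP -> bE; split => // i.
  by have /eqP := bE i; rewrite intr_eq0 oppr_eq0 => /eqP.
rewrite ratr_int (eq_bigr (fun i => - ((b i)%:~R * alpha ord0 i))) ?sumrN// => i _.
by rewrite ratr_int intrN mulNr.
Qed.

(** The index of the image differs from [c z] by a bounded amount [t], so that the
    condition on it amounts to a window for [z] up to a bounded error at either
    end. For negative [c] the window is reversed; the margin [K + 1] instead of [K]
    absorbs the change of its half-open end. *)
Lemma window_bounds (c K n t z : R) : c != 0 -> `|t| <= K ->
  let lo s := if 0 < c then (- s) / c else (n + s) / c in
  let hi s := if 0 < c then (n + s) / c else (- s) / c in
  (0 <= c * z + t < n -> lo (K + 1) <= z < hi (K + 1)) /\
  (lo (- (K + 1)) <= z < hi (- (K + 1)) -> 0 <= c * z + t < n).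
Proof.
move=> c0; rewrite ler_norml => /andP[t1 t2] lo hi; rewrite /lo /hi {lo hi}.
case: (ltP 0 c) => [cp|cn] /=.
  rewrite !ler_pdivrMr// !ltr_pdivlMr// ![z * c]mulrC.
  by split; lra.
have {}cn : c < 0 by rewrite lt_neqAle c0.
rewrite !ler_ndivrMr// !ltr_ndivlMr// ![z * c]mulrC.
by split; lra.
Qed.

Lemma window_length (c n s : R) : c != 0 ->
  (if 0 < c then (n + s) / c else (- s) / c) -
  (if 0 < c then (- s) / c else (n + s) / c) = (n + 2 * s) / `|c|.
Proof.
move=> c0; case: (ltP 0 c) => [cp|cn]; first by rewrite gtr0_norm//; field.
by rewrite ler0_norm//; field.
Qed.

Lemma bounded_linear_preimage A B S : B *m A = 1%:M -> bounded_set S ->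
  bounded_set [set y | S (y *m B)].
Proof.
move=> BA /bounded_setP[r Sr]; apply/bounded_setP.
exists ((\sum_i \sum_j `|A j i|) * r) => y /= /Sr /mulmx_coord_le => /(_ A).
by rewrite -mulmxA BA mulmx1.
Qed.

(** The induced bijection [h] of [Z x Z^d] has first coordinate [c n + O(1)] on the
    hits, so counting along [beta] is counting along [alpha] in rescaled windows. *)
Lemma bounded_remainder_matrix alpha beta A B S : (1 <= d)%N ->
  irrational_vec alpha -> irrational_vec beta ->
  A *m B = 1%:M -> B *m A = 1%:M ->
  (forall x, Zspan alpha x -> Zspan beta (x *m A)) ->
  (forall y, Zspan beta y -> Zspan alpha (y *m B)) ->
  bounded_remainder alpha S -> bounded_remainder beta [set y | S (y *m B)].
Proof.
move=> d1 ialpha ibeta AB BA ZA ZB brS.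
have [bS mS _] := brS.
have [a [b [k kE]]] := Zspan_linear_coord ZA.
pose h (v : int * 'rV[int]_d) : int * 'rV[int]_d :=
  (a * v.1 + \sum_i b i * v.2 ord0 i, k v.1 v.2).
have hE (v : int * 'rV[int]_d) : (alpha *~ v.1 + iv v.2) *m A = beta *~ (h v).1 + iv (h v).2.
  by rewrite kE.
have h_surj (w : int * 'rV[int]_d) : exists v, h v = w.
  have [n [m nm]] := ZB _ (ZspanE beta w.1 w.2).
  exists (n, m); have := hE (n, m); rewrite /= -nm -mulmxA BA mulmx1.
  by move=> /esym/(Zspan_uniq d1 ibeta)[h1 h2]; rewrite [RHS]surjective_pairing -h1 -h2.
have h_inj : injective h.
  move=> v w vw; have : (alpha *~ v.1 + iv v.2) *m A *m B = (alpha *~ w.1 + iv w.2) *m A *m B.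
    by rewrite !hE vw.
  rewrite -!mulmxA AB !mulmx1 => /(Zspan_uniq d1 ialpha)[v1 v2].
  by rewrite [LHS]surjective_pairing v1 v2 -surjective_pairing.
pose c : R := a%:~R - \sum_i (b i)%:~R * alpha ord0 i.
have c0 : c != 0.
  apply/eqP => /(Zspan_slope_eq0 ialpha)[a0 b0].
  have [v /(congr1 fst)/=] := h_surj (1, 0).
  by rewrite a0 mul0r add0r big1// => i _; rewrite b0 mul0r.
have bTS : bounded_set [set y | S (y *m B)] by exact: bounded_linear_preimage BA bS.
have mTS : M [set y | S (y *m B)].
  by apply: measurable_linear_preimage BA AB _ mS; exact: bounded_outer_fin.
have [C C0 HC] := bounded_remainder_good brS.
(* On a hit, [m = s - x - n alpha] with [s] and [x] bounded, uniformly in [y]. *)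
have [K K0 HK] : exists2 K : R, 0 <= K & forall y, Q y ->
    forall v : int * 'rV[int]_d, orbit_hits alpha S (y *m B) v -> `|(h v).1%:~R - c * v.1%:~R| <= K.
  have [r Sr] := (bounded_setP S).1 bS.
  pose r2 : R := \sum_i \sum_j `|B j i|.
  exists (\sum_i `|(b i)%:~R| * `|r + r2|) => [|y Qy v Ov].
    by apply: sumr_ge0 => i _; rewrite mulr_ge0.
  have -> : (h v).1%:~R - c * v.1%:~R =
      \sum_i (b i)%:~R * ((y *m B + alpha *~ v.1 + iv v.2) ord0 i - (y *m B) ord0 i).
    rewrite (eq_bigr (fun i => (b i * v.2 ord0 i)%:~R +
        (b i)%:~R * alpha ord0 i * v.1%:~R)); last first.
      move=> i _; rewrite mxE [(y *m B + _) _ _]mxE coordMz [iv _ _ _]mxE intrM.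
      by ring.
    by rewrite big_split -mulr_suml /c /= intrD intrM raddf_sum /=; ring.
  apply: le_trans (ler_norm_sum _ _ _) _; apply: ler_sum => i _.
  rewrite normrM ler_wpM2l//; apply: le_trans (ler_normB _ _) _.
  apply: le_trans (ler_norm _); apply: lerD; first exact: Sr.
  rewrite -[leRHS]mulr1; apply: mulmx_coord_le => j.
  by have := Qy j; rewrite ler_norml; lra.
pose D := (2 * (K + 1)) / `|c| + 1.
apply: (@bounded_remainder_mean _ _ _ _ (mes S / `|c|) (D * mes S + C)) => //.
  by rewrite divr_ge0// mes_ge0.
move=> n n1; have null : lam.-negligible ((fun x => x *m A) @` (~` [set x | good_point alpha S C x])).
  by apply/negligible_outer; exact: outer_linear_null.
apply: negligibleS null => y /= /not_implyP[Qy nC]; exists (y *m B); last by rewrite -mulmxA BA mulmx1.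
apply: contra_not nC => gx.
pose hits := orbit_hits alpha S (y *m B).
have cntE : cnt (hits `&` [set v | 0 <= (h v).1 < n%:Z]) =
    (birkhoff beta [set y | S (y *m B)] n y)%:E.
  rewrite -[y in RHS]addr0 -(mulr0z beta) -cnt_birkhoff// add0r /cnt.
  rewrite [RHS](@reindex_esum R _ _ (hits `&` [set v | 0 <= (h v).1 < n%:Z]) _ h)//.
  have hitE v : orbit_hits beta [set y | S (y *m B)] y (h v) = hits v.
    by rewrite /orbit_hits /hits /= -addrA -hE mulmxDl -mulmxA AB mulmx1 addrA.
  split=> [v [Hv hv]|v w _ _ /h_inj //|w [Hw hw]]; first by split; rewrite ?hitE.
  have [v vw] := h_surj w; exists v => //; move: Hw hw; rewrite -vw hitE.
  by move=> Hv hv; split.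
pose lo s : R := if 0 < c then (- s) / c else (n%:R + s) / c.
pose hi s : R := if 0 < c then (n%:R + s) / c else (- s) / c.
have win v : hits v -> let z := v.1%:~R in
    (0 <= (h v).1 < n%:Z -> lo (K + 1) <= z < hi (K + 1)) /\
    (lo (- (K + 1)) <= z < hi (- (K + 1)) -> 0 <= (h v).1 < n%:Z).
  move=> Hv z; have [] := @window_bounds c K n%:R _ z c0 (HK y Qy v Hv).
  rewrite -/(lo _) -/(hi _) addrC subrK ler0z => w1 w2.
  by rewrite -(ltr_int R); split.
have len s : hi s - lo s = (n%:R + 2 * s) / `|c| by exact: window_length.
have c_gt0 : 0 < `|c| by rewrite normr_gt0.
have nn : 0 <= n%:R :> R by [].
have up : ((birkhoff beta [set y | S (y *m B)] n y)%:E <=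
    ((hi (K + 1) - lo (K + 1) + 1) * mes S + C)%:E)%E.
  have [_] := good_point_cnt (lo (K + 1)) (hi (K + 1)) bS C0 gx.
  rewrite -cntE => H; apply: le_trans (H _).
    by apply: le_cnt => v [Hv hv]; split => //=; exact: (win v Hv).1.
  by rewrite -subr_ge0 len divr_ge0//; lra.
have dn : (((hi (- (K + 1)) - lo (- (K + 1)) - 1) * mes S - C)%:E <=
    (birkhoff beta [set y | S (y *m B)] n y)%:E)%E.
  have [H _] := good_point_cnt (lo (- (K + 1))) (hi (- (K + 1))) bS C0 gx.
  rewrite -cntE; apply: le_trans H _.
  by apply: le_cnt => v [Hv hv]; split => //=; exact: (win v Hv).2.
move: up dn; rewrite !lee_fin !len ler_norml => up dn.
have E s : (n%:R + 2 * s) / `|c| = n%:R / `|c| + 2 * s / `|c| by rewrite mulrDl.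
move: up dn; rewrite !E mulrN mulNr /D.
have -> : n%:R * (mes S / `|c|) = n%:R / `|c| * mes S by rewrite mulrAC mulrA.
by move=> up dn; apply/andP; split; lra.
Qed.

End Forward.

(** * A set with unbounded exchange *)

Section Gliding.
Variables (R : realType) (d : nat).
Implicit Types (E S : set 'rV[R]_d) (x y c w beta delta : 'rV[R]_d) (m : 'rV[int]_d).

Local Notation mu := (@lebesgue_outer R d).
Local Notation M := (@lebesgue_measurable R d).
Local Notation cube := (@cube R d).
Local Notation Q := (@torus_dom R d).
Local Notation iv := (@int_vec R d).
Local Notation lam := (@lebesgue_rV R d).

(** A closed cube on the torus, as a periodic set of the space. *)
Definition torus_cube c (r : R) : set 'rV[R]_d :=
  [set y | exists m, cube r (y - c + iv m)].

Lemma torus_cube_refl c r x : cube r x -> torus_cube c r (x + c).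
Proof. by move=> rx; exists 0; rewrite int_vec0 addr0 addrK. Qed.

Lemma torus_cube_shift c r v y : torus_cube c r (y + v) -> torus_cube (c - v) r y.
Proof.
by move=> [m ym]; exists m; move: ym; rewrite opprB (addrC v) addrA addrAC.
Qed.

Lemma torus_cube_periodic c r y m : torus_cube c r y -> torus_cube c r (y + iv m).
Proof.
move=> [k yk]; exists (k - m); move: yk; congr (cube r _).
by rewrite int_vecD int_vecN; apply/rowP => i; rewrite !mxE; ring.
Qed.

Lemma measurable_torus_cube c r : M (torus_cube c r).
Proof.
have -> : torus_cube c r = \bigcup_(m in setT) [set y | cube r (y + (iv m - c))].
  apply/seteqP; split=> [y [m ym]|y [m _ ym]]; exists m => //; move: ym => /=;
  by rewrite addrA addrAC.
apply: measurable_bigcup_countable; first exact: countableP.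
by move=> m _; apply: measurable_shift; exact: measurable_cube.
Qed.

Lemma outer_torus_cube_le c r : 0 < r -> (mu (torus_cube c r `&` Q) <= ((2 * r) ^+ d)%:E)%E.
Proof.
move=> r0; pose K : set 'rV[R]_d := [set x | cube r (x - c)].
have bK : bounded_set K.
  apply: bounded_shift; apply/bounded_setP; exists r => x rx i.
  by have /andP[h1 h2] := rx i; rewrite ger0_norm.
have mK : M K by apply: measurable_shift; exact: measurable_cube.
have [F KF] := chi_support bK.
apply: (@le_trans _ _ (mu K)); last first.
  by rewrite (outer_shift (- c) (cube r)); exact: outer_cube_le.
rewrite (outer_unfold mK KF).
apply: (@le_trans _ _ (mu (\bigcup_(m in [set` F]) ([set x | K (x + iv m)%R] `&` Q)))).
  apply: le_lebesgue_outer => y [[m ym] Qy].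
  have Ky : K (y + iv m) by move: ym; rewrite /K /= addrAC.
  by exists m => //; exact: (KF y Qy).
apply: le_trans (outer_bigcup _ (countableP _)) _.
rewrite esum_fset; last 2 first.
- exact: finite_fset.
- by move=> i _; exact: lebesgue_outer_ge0.
by rewrite -fsbig_seq ?fset_uniq.
Qed.

(** Some coordinate of [c - w] is not an integer; up to half of its distance to the
    integers the cubes cannot meet. *)
Lemma torus_cube_disjoint c w : (forall m, c - w <> iv m) ->
  exists2 rho : R, 0 < rho & forall r, r <= rho ->
    torus_cube c r `&` torus_cube w r = set0.
Proof.
move=> cw.
have [i ni] : exists i, forall z : int, (c - w) ord0 i <> z%:~R.
  apply: contrapT => /forallNP H.
  have H' i : exists z : int, (c - w) ord0 i = z%:~R.
    by have /existsNP[z /contrapT] := H i; exists z.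
  have [f fE] := choice H'.
  by apply: (cw (\row_i f i)); apply/rowP => i; rewrite fE !mxE.
set t := (c - w) ord0 i in ni.
have ft : (Num.floor t)%:~R < t.
  have /andP[h _] := floor_itv t; rewrite lt_neqAle h andbT.
  by apply/eqP => E; exact: (ni (Num.floor t)).
have tf : t < (Num.floor t + 1)%:~R by exact: floorD1_gt.
exists (Num.min (t - (Num.floor t)%:~R) ((Num.floor t + 1)%:~R - t) / 2).
  by rewrite divr_gt0// lt_min !subr_gt0 ft.
move=> r rle; have [r1 r2] : r * 2 <= t - (Num.floor t)%:~R /\ r * 2 <= (Num.floor t + 1)%:~R - t.
  by move: rle; rewrite ler_pdivlMr// le_min => /andP[].
apply/seteqP; split => // y [[m /(_ i) ym] [n /(_ i) yn]].
have tE : t = c ord0 i - w ord0 i by rewrite /t !mxE.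
move: ym yn; rewrite !mxE => ym yn.
have [h|h] := leP (Num.floor t + 1) (m ord0 i - n ord0 i).
  have : (Num.floor t + 1)%:~R <= (m ord0 i - n ord0 i)%:~R :> R by rewrite ler_int.
  by rewrite (intrB _ (m _ _)); lra.
have : (m ord0 i - n ord0 i)%:~R <= (Num.floor t)%:~R :> R by rewrite ler_int -ltzD1.
by rewrite intrB; lra.
Qed.

(** Exactly one integer translate of [y] lies in the fundamental domain. *)
Lemma chi_periodic E y : (forall x m, E x -> E (x + iv m)) ->
  chi (E `&` Q) y = (y \in E)%:R.
Proof.
move=> perE; rewrite (@chiE _ _ _ [fset (to_torus y)]%fset); last first.
  by move=> m [_ /to_torus_uniq ->]; rewrite inE.
rewrite big_seq_fset1 indicE; congr (_%:R); congr nat_of_bool.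
apply/idP/idP => /set_mem h; apply/mem_set.
  have [+ _] := h => /(perE _ (- to_torus y)).
  by rewrite int_vecN addrK.
by split; [exact: perE | exact: to_torusP].
Qed.

(** Radii that decrease so fast that, at every stage, the cubes of all later
    stages together are small compared with a single cube of that stage. *)
Lemma gliding_radii (rho : nat -> R) : (1 <= d)%N -> (forall j, 0 < rho j) ->
  exists r : nat -> R, [/\ forall j, 0 < r j <= 2^-1, forall j, r j <= rho j &
    forall j, (j.+1 ^ 2 * 2)%:R * (2 * r j.+1) ^+ d <= r j ^+ d / 4].
Proof.
move=> d1 rho0.
(* Stage [j + 1] has [2 (j + 1) ^ 2] bad cubes of volume at most [(2 r) ^ d]; the factor
   [u j] compensates their number once, which suffices since [1 <= d]. *)
pose u (j : nat) : R := ((j.+1 ^ 2 * 16)%:R)^-1.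
have u0 j : 0 < u j by rewrite invr_gt0 ltr0n muln_gt0 expn_gt0.
pose fix r j := if j is i.+1 then Num.min (rho i.+1) (r i * u i) else Num.min (rho 0%N) 2^-1.
have r0 j : 0 < r j.
  by elim: j => [|j IHj] /=; rewrite lt_min rho0/= ?mulr_gt0.
have u1 j : u j <= 1.
  by rewrite invf_le1 ?ltr0n ?muln_gt0 ?expn_gt0// ler1n muln_gt0 expn_gt0.
have r2 j : r j <= 2^-1.
  elim: j => [|j IHj] /=; first by rewrite ge_min lexx orbT.
  rewrite ge_min; apply/orP; right; apply: le_trans IHj.
  by rewrite ger_pMr.
exists r; split => [j|[|j]|j]; rewrite ?r0 ?r2 //=; try by rewrite ge_min lexx.
apply: (@le_trans _ _ ((j.+1 ^ 2 * 2)%:R * (r j * (2 * u j)) ^+ d)).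
  rewrite ler_pM2l ?ltr0n ?muln_gt0 ?expn_gt0//.
  apply: lerXn2r; rewrite ?nnegrE.
  - by apply/ltW/mulr_gt0 => //; rewrite lt_min rho0 mulr_gt0.
  - by apply/ltW/mulr_gt0 => //; rewrite mulr_gt0.
  - by rewrite mulrCA ler_pM2l// ge_min lexx orbT.
have uE : 2 * u j = ((j.+1 ^ 2 * 2)%:R)^-1 / 4.
  by rewrite /u !natrM; field; rewrite -?natrX ?pnatr_eq0.
have v0 : 0 < (j.+1 ^ 2 * 2)%:R :> R by rewrite ltr0n muln_gt0 expn_gt0.
have h : (2 * u j) ^+ d <= 2 * u j.
  rewrite -[leRHS]expr1; apply: ler_wiXn2l => //; first by rewrite mulr_ge0// ltW.
  rewrite uE -invfM invf_le1; last by rewrite mulr_gt0.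
  by rewrite -natrM ler1n; lia.
rewrite exprMn; apply: (@le_trans _ _ ((j.+1 ^ 2 * 2)%:R * (r j ^+ d * (2 * u j)))).
  by rewrite ler_pM2l// ler_pM2l ?exprn_gt0.
by rewrite uE mulrCA [_ * (_ / 4)]mulrA divff ?gt_eqF// mul1r.
Qed.

Section Construction.
Variables (beta delta : 'rV[R]_d) (r : nat -> R).
Hypothesis r_itv : forall j, 0 < r j <= 2^-1.
Hypothesis r_decr : forall j, (j.+1 ^ 2 * 2)%:R * (2 * r j.+1) ^+ d <= r j ^+ d / 4.
Hypothesis r_disj : forall j k l, (k < j)%N -> (l < j)%N ->
  torus_cube (beta *+ k) (r j) `&` torus_cube (beta *+ l - delta) (r j) = set0.

Definition included j : set 'rV[R]_d :=
  \bigcup_(l in `I_j) torus_cube (beta *+ l - delta) (r j).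
Definition excluded j : set 'rV[R]_d :=
  \bigcup_(l in `I_j) torus_cube (beta *+ l) (r j).

(** At a point covered by several stages the last stage decides. *)
Definition gliding_set : set 'rV[R]_d :=
  \bigcup_j (included j `\` \bigcup_(i in [set i | (j < i)%N]) excluded i).

(** Stage [i = j + s.+1] disturbs the points whose orbit meets one of its cubes with
    the opposite prescription. Times up to [i], instead of [j], make the number of
    cubes the square that the choice of the radii accounts for. *)
Definition disturbed j : set 'rV[R]_d :=
  \bigcup_s \bigcup_(p in [set p : 'I_(j + s.+1) * 'I_(j + s.+1) | true])
    (torus_cube (beta *+ p.1 - delta - beta *+ p.2) (r (j + s.+1)) `|`
     torus_cube (beta *+ p.1 - (beta *+ p.2 - delta)) (r (j + s.+1))).

Lemma gliding_set_periodic x m : gliding_set x -> gliding_set (x + iv m).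
Proof.
move=> [j _ [[l lj lx] nx]]; exists j => //; split.
  by exists l => //; exact: torus_cube_periodic.
move=> [i ji [k ki kx]]; apply: nx; exists i => //; exists k => //.
by move/(@torus_cube_periodic _ _ _ (- m)): kx; rewrite int_vecN addrK.
Qed.

Lemma measurable_gliding_set : M gliding_set.
Proof.
apply: measurable_bigcup_countable => [|j _]; first exact: countableP.
apply: measurableD.
  by apply: measurable_bigcup_countable => [|l _];
    [exact: countableP | exact: measurable_torus_cube].
apply: measurable_bigcup_countable => [|i _]; first exact: countableP.
by apply: measurable_bigcup_countable => [|l _];
    [exact: countableP | exact: measurable_torus_cube].
Qed.

(** Stage [j] prescribes this; it overrules the earlier stages, and the later ones
    do not touch an undisturbed orbit. *)
Lemma gliding_set_undisturbed j x k : cube (r j) x -> ~ disturbed j x -> (k < j)%N ->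
  gliding_set (x + beta *+ k - delta) /\ ~ gliding_set (x + beta *+ k).
Proof.
move=> rx ndx kj.
have later i : (j < i)%N -> exists s, i = (j + s.+1)%N.
  by move=> ji; exists (i - j.+1)%N; lia.
split.
  exists j => //; split; first by exists k => //=; rewrite -addrA; exact: torus_cube_refl.
  move=> [i /= ji [l /= li lx]]; apply: ndx.
  have [s iE] := later _ ji; exists s => //; rewrite -iE.
  have ki : (k < i)%N by exact: ltn_trans ji.
  exists (Ordinal li, Ordinal ki) => //; right => /=.
  by apply: torus_cube_shift; rewrite addrA.
move=> [i _ [[l /= li lx] nx]].
have [ij|ji|ij] := ltngtP i j.
- by apply: nx; exists j => //; exists k => //; exact: torus_cube_refl.
- apply: ndx; have [s iE] := later _ ji; exists s => //; rewrite -iE.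
  have ki : (k < i)%N by exact: ltn_trans ji.
  exists (Ordinal li, Ordinal ki) => //; left => /=.
  exact: torus_cube_shift.
- subst i; have : (torus_cube (beta *+ k) (r j) `&`
      torus_cube (beta *+ l - delta) (r j)) (x + beta *+ k).
    by split => //; exact: torus_cube_refl.
  by rewrite r_disj.
Qed.

(** By the choice of the radii the stages after [j] contribute a geometric series
    with sum at most [r j ^+ d / 2]. *)
Lemma outer_disturbed j : (mu (disturbed j `&` Q) <= (r j ^+ d / 2)%:E)%E.
Proof.
have r0 i : 0 < r i by have /andP[] := r_itv i.
have rd i : r i.+1 ^+ d <= r i ^+ d / 2.
  apply: (@le_trans _ _ ((i.+1 ^ 2 * 2)%:R * (2 * r i.+1) ^+ d)); last first.
    apply: le_trans (r_decr i) _; rewrite ler_pM2l ?exprn_gt0//.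
    by rewrite lef_pV2 ?posrE// ler_nat.
  rewrite -[leLHS]mul1r; apply: ler_pM => //; first by rewrite exprn_ge0// ltW.
    by rewrite ler1n muln_gt0 expn_gt0.
  apply: lerXn2r; rewrite ?nnegrE; [exact: ltW|by apply/ltW/mulr_gt0|].
  by apply: ltW; rewrite ltr_pMl// ltr1n.
have rds s : r (j + s)%N ^+ d <= r j ^+ d / (2 ^ s)%:R.
  elim: s => [|s IHs]; first by rewrite addn0 expn0 divr1.
  rewrite addnS; apply: le_trans (rd _) _.
  by rewrite expnS mulnC natrM invfM mulrA ler_pM2r.
pose Cu s (p : 'I_(j + s.+1) * 'I_(j + s.+1)) :=
  torus_cube (beta *+ p.1 - delta - beta *+ p.2) (r (j + s.+1)) `|`
     torus_cube (beta *+ p.1 - (beta *+ p.2 - delta)) (r (j + s.+1)).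
have stage s : (mu (\bigcup_(p in [set p | true]) (Cu s p `&` Q)) <=
    ((r j ^+ d / 2) / (2 ^ s.+1)%:R)%:E)%E.
  apply: le_trans (outer_fin_bigcup_le (P := xpredT) (c := 2 * (2 * r (j + s.+1)) ^+ d) _) _.
    move=> p _; rewrite setIUl; apply: le_trans (outerU _ _) _.
    by rewrite mulr_natl mulr2n EFinD; apply: leeD; exact: outer_torus_cube_le.
  rewrite lee_fin card_prod card_ord addnS.
  have := r_decr (j + s); rewrite natrM -mulnn => h.
  rewrite mulrA; apply: le_trans h _.
  apply: (@le_trans _ _ (r j ^+ d / (2 ^ s)%:R / 4)); first by rewrite ler_pM2r.
  rewrite expnS natrM invfM; set e := (2 ^ s)%:R^-1.
  by rewrite le_eqVlt; apply/orP; left; apply/eqP; field.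
apply: (@le_trans _ _ (mu (\bigcup_s \bigcup_(p in [set p | true]) (Cu s p `&` Q)))).
  apply: le_lebesgue_outer => x [[s _ [p _ px]] Qx].
  by exists s => //; exists p.
apply: le_trans (lebesgue_outer_sigma_subadditive _) _.
apply: (@le_trans _ _ (\sum_(0 <= s <oo) (0 + ((r j ^+ d / 2) / (2 ^ s.+1)%:R)%:E))%E).
  by apply: lee_nneseries => [s _ _|s _]; [exact: lebesgue_outer_ge0|rewrite add0e].
apply: le_trans (epsilon_trick _ _ _) _ => //; first by rewrite divr_ge0// exprn_ge0// ltW.
by rewrite eseries0// add0e.
Qed.

(** On the undisturbed part of the cube of stage [j], which has positive measure,
    the difference of the two sums is [j]. *)
Lemma gliding_set_unbounded (C : R) : exists2 n, (1 <= n)%N &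
  ~ {ae lam, forall y, Q y -> `|birkhoff beta (gliding_set `&` Q) n (y - delta) -
                              birkhoff beta (gliding_set `&` Q) n y| <= C}.
Proof.
pose j := (Num.trunc C).+1; exists j => // H.
have r0 : 0 < r j by have /andP[] := r_itv j.
have r2 : r j <= 2^-1 by have /andP[] := r_itv j.
have rQ x : cube (r j) x -> Q x by move=> rx i; have := rx i; lra.
pose N := ~` [set y | Q y -> `|birkhoff beta (gliding_set `&` Q) j (y - delta) -
                              birkhoff beta (gliding_set `&` Q) j y| <= C].
have N0 : mu N = 0%E by apply/negligible_outer; exact: H.
have sub : cube (r j) `<=` N `|` (disturbed j `&` Q).
  move=> x rx; have [dx|ndx] := pselect (disturbed j x); [by right; split => //; exact: rQ|left].
  move=> /(_ (rQ _ rx)); apply/negP; rewrite -ltNge.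
  suff -> : birkhoff beta (gliding_set `&` Q) j (x - delta) -
      birkhoff beta (gliding_set `&` Q) j x = j%:R.
    by rewrite ger0_norm//; exact: truncnS_gt.
  rewrite /birkhoff -sumrB big_nat_cond (eq_bigr (fun=> 1)); last first.
    move=> k /andP[/andP[_ kj] _]; have [h1 h2] := gliding_set_undisturbed rx ndx kj.
    rewrite !(chi_periodic _ gliding_set_periodic) addrAC mem_set// memNset//.
    by rewrite subr0.
  by rewrite -big_nat_cond big_const_nat subn0 iter_addr_0.
have := le_trans (outer_cube_ge d r0) (le_lebesgue_outer sub).
rewrite leNgt => /negP; apply; apply: le_lt_trans (outerU _ _) _.
rewrite N0 add0e; apply: le_lt_trans (outer_disturbed j) _.
by rewrite lte_fin ltr_pdivrMr// ltr_pMr ?exprn_gt0// ltr1n.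
Qed.

End Construction.

(** The points [k beta] and [l beta - delta] never coincide on the torus, so the
    radii can be chosen to separate them at every stage. *)
Lemma exists_unbounded_set beta delta : (1 <= d)%N -> ~ Zspan beta delta ->
  exists E, [/\ E `<=` Q, M E & forall C : R, exists2 n, (1 <= n)%N &
  ~ {ae lam, forall y, Q y ->
      `|birkhoff beta E n (y - delta) - birkhoff beta E n y| <= C}].
Proof.
move=> d1 nd.
have rhoP j : exists rho : R, 0 < rho /\ forall r, r <= rho ->
   forall k l, (k < j)%N -> (l < j)%N ->
  torus_cube (beta *+ k) r `&` torus_cube (beta *+ l - delta) r = set0.
  have step (p : 'I_j * 'I_j) : exists rho : R, 0 < rho /\ forall r, r <= rho ->
      torus_cube (beta *+ p.1) r `&` torus_cube (beta *+ p.2 - delta) r = set0.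
    have [m E|rho rho0 H] := @torus_cube_disjoint (beta *+ p.1) (beta *+ p.2 - delta).
      apply: nd; exists (p.2%:Z - p.1%:Z), m.
      by rewrite -E mulrzBr -!pmulrn; apply/rowP => i; rewrite !mxE; ring.
    by exists rho.
  have [f fP] := choice step.
  have [|s s0 sf] := @fin_pos_lb R _ f; first by move=> p; have [] := fP p.
  exists s; split => // r rs k l kj lj.
  have [_ ] := fP (Ordinal kj, Ordinal lj); apply; exact: le_trans (sf _).
have [rho rhoE] := choice rhoP.
have [|r [r_itv r_rho r_decr]] := @gliding_radii rho d1; first by move=> j; have [] := rhoE j.
exists (gliding_set beta delta r `&` Q); split => [x []//||C].
  apply: measurableI; [exact: measurable_gliding_set | exact: measurable_torus_dom].
apply: gliding_set_unbounded => // j k l kj lj.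
by have [_] := rhoE j; apply.
Qed.

End Gliding.

(** * Exchanging a set for a translate *)

Section Exchange.
Variables (R : realType) (d : nat).
Implicit Types (E S : set 'rV[R]_d) (x y g alpha beta : 'rV[R]_d) (m : 'rV[int]_d).
Implicit Types (A B : 'M[R]_d).

Local Notation mu := (@lebesgue_outer R d).
Local Notation M := (@lebesgue_measurable R d).
Local Notation Q := (@torus_dom R d).
Local Notation iv := (@int_vec R d).
Local Notation lam := (@lebesgue_rV R d).

Lemma chi_bounded S : bounded_set S -> exists2 c : R, 0 <= c & forall x, chi S x <= c.
Proof.
move=> bS; have [F SF] := chi_support bS.
exists (\sum_(m <- F) 1) => [|x]; first by apply: sumr_ge0.
rewrite -(chi_shift_int S (to_torus x)) (chiE (SF _ (to_torusP x))).
by apply: ler_sum => m _; rewrite indicE lern1 leq_b1.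
Qed.

(** Shifting by one step telescopes; larger shifts are compositions of single
    steps. *)
Lemma shifted_sum_le (f : int -> R) (c : R) (p : int) : (forall k, 0 <= f k <= c) ->
  forall n, `|\sum_(0 <= k < n) (f (k%:Z - p) - f k%:Z)| <= (absz p)%:R * c.
Proof.
have nonneg (q : nat) : forall f : int -> R, (forall k, 0 <= f k <= c) ->
    forall n, `|\sum_(0 <= k < n) (f (k%:Z - q%:Z) - f k%:Z)| <= q%:R * c.
  move=> {}f fc n; elim: q => [|q IHq].
    by rewrite big1 ?normr0 ?mul0r// => k _; rewrite subr0 subrr.
  rewrite (eq_bigr (fun k : nat => (f (k%:Z - q.+1%:Z) - f (k.+1%:Z - q.+1%:Z)) +
      (f (k%:Z - q%:Z) - f k%:Z))); last first.
    move=> k _; rewrite (_ : k.+1%:Z - q.+1%:Z = k%:Z - q%:Z); last by lia.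
    by rewrite addrA subrK.
  rewrite big_split /=; apply: le_trans (ler_normD _ _) _.
  rewrite -natr1 mulrDl mul1r addrC; apply: lerD => //.
  rewrite -[X in `|X|]opprK -sumrN (eq_bigr (fun k : nat =>
      f (k.+1%:Z - q.+1%:Z) - f (k%:Z - q.+1%:Z))); last first.
    by move=> k _; rewrite opprB.
  rewrite (telescope_sumr (fun k : nat => f (k%:Z - q.+1%:Z)))// normrN.
  have := fc (n%:Z - q.+1%:Z); have := fc (0%:Z - q.+1%:Z).
  by rewrite ler_norml; lra.
move=> fc n; case: p => [q|q]; first exact: nonneg.
have := nonneg q.+1 (fun k => f (k + q.+1%:Z)) (fun k => fc _) n.
rewrite -normrN -sumrN; congr (`|_| <= _); apply: eq_bigr => k _.
by rewrite subrK opprB NegzE opprK.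
Qed.

Lemma birkhoff_shift_le alpha S (p : int) : bounded_set S -> exists C : R,
  forall n x, `|birkhoff alpha S n (x - alpha *~ p) - birkhoff alpha S n x| <= C.
Proof.
move=> bS; have [c c0 Sc] := chi_bounded bS; exists ((absz p)%:R * c) => n x.
have := @shifted_sum_le (fun k => chi S (x + alpha *~ k)) c p _ n.
rewrite /birkhoff -sumrB => H; apply: le_trans (H _); last by move=> k; rewrite chi_ge0 Sc.
rewrite le_eqVlt; apply/orP; left; apply/eqP; congr (`|_|); apply: eq_bigr => k _.
by rewrite mulrzBr -pmulrn; congr (chi S _ - _); rewrite addrAC addrA.
Qed.

Definition exchange (B0 E : set 'rV[R]_d) g : set 'rV[R]_d :=
  (B0 `\` E) `|` [set x | E (x - g)].

Section ExchangeProperties.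
Variables (B0 E : set 'rV[R]_d) (g : 'rV[R]_d).
Hypothesis EB : E `<=` B0.
Hypothesis disj : forall x, B0 x -> ~ E (x - g).

Lemma exchange_indic x : (\1_(exchange B0 E g) x : R) = \1_B0 x - \1_E x + \1_E (x - g).
Proof.
rewrite !indicE.
have [Bx|nBx] := pselect (B0 x).
  have nEg := disj Bx; have [Ex|nEx] := pselect (E x).
    rewrite (mem_set Bx) (mem_set Ex) (memNset nEg) memNset; first by rewrite subrr addr0.
    by move=> [[]|].
  rewrite (mem_set Bx) (memNset nEx) (memNset nEg) mem_set; first by rewrite subr0 addr0.
  by left.
have nEx : ~ E x by move=> /EB.
rewrite (memNset nBx) (memNset nEx) subrr add0r; congr (_%:R); congr nat_of_bool.
apply/idP/idP => /set_mem h; apply/mem_set; last by right.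
by case: h => [[/nBx]|].
Qed.

Lemma exchange_chi x : bounded_set B0 ->
  chi (exchange B0 E g) x = chi B0 x - chi E x + chi E (x - g).
Proof.
move=> bB; have bE : bounded_set E by exact: bounded_subset bB.
have [F1 H1] := chi_support_at x bB.
have [F2 H2] := chi_support_at (x - g) bE.
pose F := (F1 `|` F2)%fset.
have Bx m : B0 (x + iv m) -> m \in F by move=> /H1; rewrite !inE => ->.
have Ex m : E (x + iv m) -> m \in F by move=> /EB/Bx.
have Eg m : E (x - g + iv m) -> m \in F by move=> /H2; rewrite !inE => ->; rewrite orbT.
rewrite (chiE Bx) (chiE Ex) (chiE Eg) (@chiE _ _ _ F); last first.
  by move=> m [[/Bx]//|/=]; rewrite addrAC => /Eg.
rewrite -sumrB -big_split; apply: eq_bigr => m _ /=.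
by rewrite exchange_indic [x - g + _]addrAC.
Qed.

Lemma exchange_birkhoff alpha n x : bounded_set B0 ->
  birkhoff alpha (exchange B0 E g) n x =
  birkhoff alpha B0 n x - birkhoff alpha E n x + birkhoff alpha E n (x - g).
Proof.
move=> bB; rewrite /birkhoff -sumrB -big_split; apply: eq_bigr => k _ /=.
by rewrite exchange_chi// [x - g + _]addrAC.
Qed.

Lemma exchange_mes : M E -> mes (exchange B0 E g) = mes B0.
Proof.
move=> mE; congr fine.
have mD : M [set x | E (x - g)] by exact: measurable_shift.
have cutD : mu (exchange B0 E g) = (mu (exchange B0 E g `&` [set x | E (x - g)%R]) +
    mu (exchange B0 E g `&` ~` [set x | E (x - g)%R]))%E by exact: mD.
have cutE : mu B0 = (mu (B0 `&` E) + mu (B0 `&` ~` E))%E by exact: mE.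
apply: etrans cutD _.
rewrite (_ : exchange B0 E g `&` [set x | E (x - g)] = [set x | E (x - g)]); last first.
  by apply/setIidPr; exact: subsetUr.
rewrite (_ : exchange B0 E g `&` ~` [set x | E (x - g)] = B0 `&` ~` E); last first.
  apply/seteqP; split=> [x [[//|//]]|x [Bx nEx]]; split; last exact: disj.
  by left.
by rewrite outer_shift [RHS]cutE (setIidr EB).
Qed.

Lemma measurable_exchange : M B0 -> M E -> M (exchange B0 E g).
Proof.
move=> mB mE; apply: measurableU; first exact: measurableD.
exact: measurable_shift.
Qed.

Lemma bounded_exchange : bounded_set B0 -> bounded_set (exchange B0 E g).
Proof.
move=> bB; have /bounded_setP[r1 H1] := bB.
have /bounded_setP[r2 H2] := bounded_shift (- g) (bounded_subset EB bB).
apply/bounded_setP; exists (Num.max r1 r2) => x [[Bx _]|Ex] i; rewrite le_max.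
  by rewrite H1.
by rewrite (H2 x Ex) orbT.
Qed.

End ExchangeProperties.

(** A union of integer translates of the fundamental domain covers the torus
    evenly, and contains any given cube if there are enough of them. *)
Lemma exists_cell_block (r : R) : exists B0 : set 'rV[R]_d,
  [/\ bounded_set B0, M B0, (forall x, (forall i, `|x ord0 i| <= r) -> B0 x) &
    exists kappa : nat, forall x, chi B0 x = kappa%:R].
Proof.
have /finite_fsetP[G GE] := finite_int_vec d (r + 1).
have inG m : m \in G <-> forall i, `|(m ord0 i)%:~R : R| <= r + 1.
  by have -> : (m \in G) = ([set` G] m) :> Prop by []; rewrite -GE.
exists [set x | to_torus x \in G]; split.
- apply/bounded_setP; exists (r + 3) => x /= /inG xG i.
  have := xG i; rewrite mxE intrN normrN !ler_norml.
  by have := floor_itv (x ord0 i); rewrite intrD; lra.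
- have -> : [set x | to_torus x \in G] = \bigcup_(m in [set` G]) [set x | Q (x + iv m)].
    apply/seteqP; split=> [x xG|x [m /= mG /to_torus_uniq <-]//].
    by exists (to_torus x) => //=; exact: to_torusP.
  apply: measurable_bigcup_countable => [|m _]; first exact: countableP.
  by apply: measurable_shift; exact: measurable_torus_dom.
- move=> x xr /=; apply/inG => i; rewrite mxE intrN normrN.
  have := xr i; rewrite !ler_norml.
  by have := floor_itv (x ord0 i); rewrite intrD; lra.
exists (size (enum_fset G)) => x.
rewrite /chi (reindex_fsbigT (fun k => to_torus x - k)); last first.
  by exists (fun k => to_torus x - k) => k; rewrite opprB addrC subrK.
have shiftE k : to_torus (x + iv (to_torus x - k)) = k.
  by apply/esym/to_torus_uniq; rewrite int_vecD int_vecN addrA subrK; exact: to_torusP.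
rewrite (fsbigTE G); last first.
  by move=> k kG; rewrite indicE memNset// /= shiftE; exact/negP.
rewrite big_seq (eq_bigr (fun=> 1)); last first.
  by move=> k kG; rewrite indicE mem_set//= shiftE.
by rewrite -big_seq big_const_seq count_predT iter_addr_0.
Qed.

Lemma ZspanB alpha x y : Zspan alpha x -> Zspan alpha y -> Zspan alpha (x - y).
Proof.
move=> [n [m ->]] [n' [m' ->]]; exists (n - n'), (m - m').
by rewrite mulrzBr int_vecD int_vecN opprD addrACA.
Qed.

Lemma ZspanMn alpha x n : Zspan alpha x -> Zspan alpha (x *+ n).
Proof.
move=> Zx; elim: n => [|n IHn].
  by exists 0, 0; rewrite mulr0n mulr0z int_vec0 addr0.
have Z0 : Zspan alpha 0 by exists 0, 0; rewrite mulr0z int_vec0 addr0.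
by rewrite mulrSr -[x in _ + x]opprK -[- x]sub0r; apply: ZspanB => //; exact: ZspanB.
Qed.

(** An element with image outside [Zspan beta] can be moved far away along a
    coordinate axis: if two consecutive translates both had image in the group,
    so would the axis vector, and then the element itself. *)
Lemma far_counterexample alpha beta A (i : 'I_d) x (t : R) :
  Zspan alpha x -> ~ Zspan beta (x *m A) ->
  exists g, [/\ Zspan alpha g, ~ Zspan beta (g *m A) & t < g ord0 i].
Proof.
move=> [p [m ->]] nx; set x0 := _ + _ in nx *.
pose e : 'rV[R]_d := iv (delta_mx 0 i).
have eE j : e ord0 j = (j == i)%:R by rewrite !mxE eqxx/=; case: (j == i).
pose N := (Num.trunc (`|t - x0 ord0 i|)).+1.
have Ze n : Zspan alpha (x0 + e *+ n).
  exists p, (m + delta_mx 0 i *+ n); rewrite int_vecD addrA; congr (_ + _).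
  by rewrite /e /int_vec raddfMn.
have far n : (N <= n)%N -> t < (x0 + e *+ n) ord0 i.
  move=> Nn; rewrite mxE mulmxnE eE eqxx -ltrBlDl.
  apply: le_lt_trans (ler_norm _) _; apply: lt_le_trans (truncnS_gt _) _.
  by rewrite ler_nat.
have [nN|ZN] := pselect (~ Zspan beta ((x0 + e *+ N) *m A)).
  by exists (x0 + e *+ N); split => //; exact: far.
exists (x0 + e *+ N.+1); split => //; last exact: far.
move=> ZN1; apply: nx; move: ZN => /contrapT ZN.
have -> : x0 *m A = (x0 + e *+ N) *m A - ((x0 + e *+ N.+1) *m A - (x0 + e *+ N) *m A) *+ N.
  have -> : (x0 + e *+ N.+1) *m A - (x0 + e *+ N) *m A = e *m A.
    by rewrite -mulmxBl mulrSr addrA [x0 + e *+ N + e]addrC addrK.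
  rewrite [(x0 + e *+ N) *m A]mulmxDl.
  by rewrite -(@scaler_nat R _ N e) -scalemxAl scaler_nat addrK.
by apply: ZspanB => //; apply: ZspanMn; exact: ZspanB.
Qed.

(** Otherwise exchange the preimage of the set of [exists_unbounded_set] inside a
    block of cells: the block and its exchanged copy are bounded remainder sets for
    [alpha], and their images would bound what is unbounded. *)
Lemma Zspan_of_preserved alpha beta A B : (1 <= d)%N ->
  A *m B = 1%:M -> B *m A = 1%:M ->
  (forall S, bounded_set S -> M S ->
    bounded_remainder alpha S -> bounded_remainder beta [set y | S (y *m B)]) ->
  forall x, Zspan alpha x -> Zspan beta (x *m A).
Proof.
move=> d1 AB BA H x0 Zx0; apply: contrapT => nx0.
pose r0 : R := \sum_i \sum_j `|B j i|.
have QB y : Q y -> forall i, `|(y *m B) ord0 i| <= r0.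
  move=> Qy i; rewrite -[leRHS]mulr1; apply: mulmx_coord_le => j.
  by have := Qy j; rewrite ler_norml; lra.
have [B0 [bB mB rB [kappa chiB]]] := exists_cell_block r0.
have [r1 B1] := (bounded_setP B0).1 bB.
have [g [[p [m gE]] ng gfar]] := far_counterexample (Ordinal d1) (r1 + r0) Zx0 nx0.
have [E [EQ mE Eunb]] := exists_unbounded_set d1 ng.
have bQ : bounded_set Q.
  apply/bounded_setP; exists 1 => y Qy i.
  by have := Qy i; rewrite ler_norml; lra.
have bE : bounded_set E by exact: bounded_subset bQ.
pose A0 := [set x | E (x *m A)].
have mA0 : M A0.
  by apply: measurable_linear_preimage AB BA _ mE; exact: bounded_outer_fin.
have A0r x : A0 x -> forall i, `|x ord0 i| <= r0.
  by move=> /EQ/QB; rewrite -mulmxA AB mulmx1.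
have A0B : A0 `<=` B0 by move=> x /A0r/rB.
have disj x : B0 x -> ~ A0 (x - g).
  move=> /B1/(_ (Ordinal d1)) h1 /A0r/(_ (Ordinal d1)); rewrite !mxE.
  by move: h1; rewrite !ler_norml; lra.
have bA0 : bounded_set A0 by exact: bounded_subset bB.
have birkB n y : birkhoff alpha B0 n y = n%:R * kappa%:R.
  rewrite /birkhoff (eq_bigr (fun=> kappa%:R)) => [|k _]; last exact: chiB.
  by rewrite big_const_nat subn0 iter_addr_0 mulr_natl.
have brB : bounded_remainder alpha B0.
  apply: (@bounded_remainder_mean _ _ _ _ kappa%:R 0) => // n _.
  by apply: aeW => y _; rewrite birkB subrr normr0.
pose S := exchange B0 A0 g.
have bS : bounded_set S by exact: bounded_exchange.
have mS : M S by exact: measurable_exchange.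
have brS : bounded_remainder alpha S.
  have [C HC] := birkhoff_shift_le alpha p bA0.
  apply: (@bounded_remainder_mean _ _ _ _ kappa%:R C) => // n _.
  apply: aeW => y _; rewrite exchange_birkhoff// birkB.
  rewrite [X in `|X|](_ : _ = birkhoff alpha A0 n (y - alpha *~ p) - birkhoff alpha A0 n y).
    exact: HC.
  rewrite gE opprD addrA -int_vecN birkhoff_shift_int; ring.
have brTB := H _ bB mB brB.
have := H _ bS mS brS.
have -> : [set y | S (y *m B)] = exchange [set y | B0 (y *m B)] E (g *m A).
  have A0E y : A0 (y *m B) = E y by rewrite /A0 /= -mulmxA BA mulmx1.
  have A0gE y : A0 (y *m B - g) = E (y - g *m A).
    by rewrite /A0 /= mulmxBl -mulmxA BA mulmx1.
  by apply/seteqP; split=> y; rewrite /S /exchange /= A0E A0gE.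
have ETB : E `<=` [set y | B0 (y *m B)].
  by move=> y Ey /=; apply: A0B; rewrite /A0 /= -mulmxA BA mulmx1.
have disjT y : [set y | B0 (y *m B)] y -> ~ E (y - g *m A).
  move=> /= /disj; rewrite /A0 /= mulmxBl -mulmxA BA mulmx1; exact.
case: brTB => bTB _ [C1 H1] [_ _ [C2 H2]].
have [n n1] := Eunb (C1 + C2); apply.
apply: negligibleS (negligibleU (H1 n n1) (H2 n n1)).
move=> y /= /not_implyP[Qy nC]; apply: contrapT => /not_orP[/contrapT h1 /contrapT h2].
apply: nC; have := h1 Qy; have := h2 Qy.
rewrite -/(birkhoff _ _ _ _) -/(birkhoff _ _ _ _) exchange_birkhoff// exchange_mes//.
by rewrite !ler_norml; lra.
Qed.

End Exchange.

(** * The equivalence *)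

Lemma bijective_linear_matrix (R : realType) (d : nat)
    (T : {linear 'rV[R]_d -> 'rV[R]_d}) : bijective T ->
  exists A B : 'M[R]_d, [/\ A *m B = 1%:M, B *m A = 1%:M, forall x, T x = x *m A &
    forall S, T @` S = [set y | S (y *m B)]].
Proof.
move=> [T' TK T'K]; pose A := lin1_mx T.
have TE x : T x = x *m A by rewrite mul_rV_lin1.
pose B : 'M[R]_d := \matrix_i T' (delta_mx 0 i).
have BA : B *m A = 1%:M.
  by apply/row_matrixP => i; rewrite row_mul rowK -TE T'K row1.
have AB : A *m B = 1%:M by exact: mulmx1C.
exists A, B; split => // S; apply/seteqP; split=> [_ [x Sx <-]|y Sy] /=.
  by rewrite TE -mulmxA AB mulmx1.
by exists (y *m B) => //; rewrite TE -mulmxA BA mulmx1.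
Qed.

Unset Implicit Arguments.

Theorem theorem6p2 (R : realType) (d : nat) (hd : (1 <= d)%N)
    (alpha beta : 'rV[R]_d)
    (halpha : irrational_vec alpha) (hbeta : irrational_vec beta)
    (T : {linear 'rV[R]_d -> 'rV[R]_d}) (hT : bijective T) :
  T @` Zspan alpha = Zspan beta <->
  (forall S : set 'rV[R]_d, bounded_set S -> lebesgue_measurable S ->
     (bounded_remainder alpha S <-> bounded_remainder beta (T @` S))).
Proof.
have [A [B [AB BA TE imT]]] := bijective_linear_matrix hT.
split=> [TZ S bS mS|H].
  have ZA x : Zspan alpha x -> Zspan beta (x *m A).
    by move=> Zx; rewrite -TZ -TE; exists x.
  have ZB y : Zspan beta y -> Zspan alpha (y *m B).
    by rewrite -TZ imT.
  rewrite imT; split; first exact: (bounded_remainder_matrix hd halpha hbeta AB BA ZA ZB).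
  move=> /(bounded_remainder_matrix hd hbeta halpha BA AB ZB ZA) /=.
  suff -> : [set y | S (y *m A *m B)] = S by [].
  by apply/seteqP; split=> x /=; rewrite -mulmxA AB mulmx1.
have ZA x : Zspan alpha x -> Zspan beta (x *m A).
  apply: (Zspan_of_preserved hd AB BA) => // S bS mS.
  by rewrite -imT => /(H S bS mS).
have ZB y : Zspan beta y -> Zspan alpha (y *m B).
  apply: (Zspan_of_preserved hd BA AB) => // S bS mS brS.
  have bU : bounded_set [set x | S (x *m A)] by exact: bounded_linear_preimage AB bS.
  have mU : lebesgue_measurable [set x | S (x *m A)].
    by apply: measurable_linear_preimage AB BA _ mS; exact: bounded_outer_fin.
  apply/(H _ bU mU); rewrite imT.
  suff -> : [set y | S (y *m B *m A)] = S by [].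
  by apply/seteqP; split=> x /=; rewrite -mulmxA BA mulmx1.
rewrite imT; apply/seteqP; split=> y /=; last exact: ZB.
by move=> /ZA; rewrite -mulmxA BA mulmx1.
Qed.
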